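(* Let $\Omega\subset\mathbb{C}$ be a domain, $u:\Omega\to\mathbb{R}$, and let $f_0:\Omega\to\mathbb{R}$ be a nonvanishing solution of the Schrödinger equation $(-\Delta+u)f=0$ in $\Omega$. Put $b=-\dfrac{\partial_{\overline z}f_0}{f_0}$. Let $w:\Omega\to\mathbb{C}$ be a solution of the equation $$w_{\overline z}=b\,\overline{w}.$$ Then the function $$v=i\left(w_z+\frac{\partial_zf_0}{f_0}\,\overline{w}\right)$$ is a solution of the equation $$v_{\overline z}=\overline{b}\,\overline{v}.$$
   Context: $z=x+iy$. The operators are defined without the factor $1/2$: $\partial_{\overline z}=\frac{\partial}{\partial x}+i\frac{\partial}{\partial y}$, $\partial_z=\frac{\partial}{\partial x}-i\frac{\partial}{\partial y}$; the subscripts $\overline z$, $z$ denote application of these operators, and $\Delta=\partial_z\partial_{\overline z}=\frac{\partial^2}{\partial x^2}+\frac{\partial^2}{\partial y^2}$. Solutions are classical: $f_0$ is twice continuously differentiable, $w$ is continuously differentiable. *)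

(* Defs.v *)
From Stdlib Require Import Reals.
From Coquelicot Require Import Coquelicot.

Local Open Scope R_scope.

(* Stdlib reals with Coquelicot.  A function on a domain Omega of C is encoded
   as a total function on C; since Omega is open, everything below that is
   asserted at the points of Omega depends only on its values on Omega. *)

Definition connected_in (A : C -> Prop) : Prop :=
  forall U V : C -> Prop,
    open U -> open V ->
    (forall z, A z -> U z \/ V z) ->
    (exists z, A z /\ U z) -> (exists z, A z /\ V z) ->
    exists z, A z /\ U z /\ V z.

Definition is_domain (Omega : C -> Prop) : Prop :=
  open Omega /\ (exists z, Omega z) /\ connected_in Omega.

(* [ex_diff_n] already includes the continuity, at the given point, of the
   function and of all its partial derivatives up to the given order. *)
Definition Cn_on (n : nat) (Omega : C -> Prop) (g : C -> R) : Prop :=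
  forall x y : R, Omega (x, y) -> ex_diff_n (fun s t => g (s, t)) n x y.

Definition C1_on (Omega : C -> Prop) (f : C -> C) : Prop :=
  Cn_on 1 Omega (fun z => Re (f z)) /\ Cn_on 1 Omega (fun z => Im (f z)).

Definition pdx (g : C -> R) (z : C) : R := Derive (fun s => g (s, Im z)) (Re z).
Definition pdy (g : C -> R) (z : C) : R := Derive (fun t => g (Re z, t)) (Im z).

Definition cpdx (f : C -> C) (z : C) : C :=
  (pdx (fun s => Re (f s)) z, pdx (fun s => Im (f s)) z).
Definition cpdy (f : C -> C) (z : C) : C :=
  (pdy (fun s => Re (f s)) z, pdy (fun s => Im (f s)) z).

(* Without the customary factor 1/2, so that d_z (d_zbar f) is the Laplacian. *)
Definition d_zbar (f : C -> C) (z : C) : C := (cpdx f z + Ci * cpdy f z)%C.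
Definition d_z (f : C -> C) (z : C) : C := (cpdx f z - Ci * cpdy f z)%C.

Definition laplacian (g : C -> R) (z : C) : R := pdx (pdx g) z + pdy (pdy g) z.

Definition schrodinger_solution
    (Omega : C -> Prop) (u : C -> R) (f : C -> R) : Prop :=
  Cn_on 2 Omega f /\
  forall z, Omega z -> - laplacian f z + u z * f z = 0.

(* Classical solutions of w_zbar = a * conj w. *)
Definition vekua_solution
    (Omega : C -> Prop) (a : C -> C) (w : C -> C) : Prop :=
  C1_on Omega w /\
  forall z, Omega z -> d_zbar w z = (a z * Cconj (w z))%C.

(* Main.v *)
Require Import Defs.
From Stdlib Require Import Reals Lra Psatz ClassicalEpsilon.
From Coquelicot Require Import Coquelicot.
Local Open Scope R_scope.

(** Formally the equation for [v] is a computation: applying [d_zbar] to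
    [d_z w + (d_z f0 / f0) * conj w] and using [d_zbar w = b * conj w], the terms
    with second derivatives of [f0] cancel, because [d_z b] is minus the
    Laplacian of [ln |f0|], hence real.  The difficulty is that [w] is only
    continuously differentiable, so that [v] is a priori only continuous: that
    [v] is continuously differentiable is an elliptic regularity statement.

    The derivative with respect to [conj z] is therefore first taken in
    Pompeiu's areolar sense ([has_dbar]): the limit of contour integrals over
    small rectangles divided by their area.  The areolar derivative obeys the
    rules needed for the formal computation; [has_dbar_d_z] gives it for [d_z w],
    because [dw] is exact.  Thus [v] satisfies the equation in the areolar sense,
    and it remains to prove that [v] is continuously differentiable
    ([pompeiu_C1]), after which areolar and classical derivatives agree.

    For this put [psi = Im w / f0].  The equation for [w] gives
    [v = - 2 * f0 * d_z psi], so that for every centre [z0] the areolar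
    derivative of [v - 2 * d_z f0 * (psi - psi z0)] at [z] is
    [- 2 * laplacian f0 z * (psi z - psi z0)].  It vanishes at [z0] to first
    order, because [psi] is continuously differentiable: this replaces any
    Hoelder estimate.  Let [F] be this function minus its value at [z0].
    Integrating [F q / ((q - z0) * (q - z))] over a square of half side [R]
    around [z0] gives [2 * PI * Ci * F z / (z - z0)] up to an error of order
    [R] ([cauchy_pompeiu_quotient]).  For fixed [R] the integral is continuous
    in [z] up to [z0], so the difference quotients of [F] at [z0] converge,
    uniformly in [z0], which makes the derivatives of [v] exist and be
    continuous.

    All area integrals are avoided by a domination principle
    ([dbar_dominated]): by Goursat's bisection, if the areolar derivative of [h]
    is bounded by that of [m], then contour integrals of [h] are bounded by
    those of [m].  The singular weight [1 / r] is the areolar derivative of a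
    bounded function ([weight]). *)

(** * Continuity and real differentiability of complex functions *)

(** The balls of the uniform structure on C are squares; all estimates below
    are in the modulus, so neighbourhoods are transferred to discs once. *)
Lemma locally_Cmod (p : C) (P : C -> Prop) :
  locally p P <-> exists d, 0 < d /\ forall z, Cmod (z - p) < d -> P z.
Proof.
split.
- intros [d Hd]; exists d; split; [apply cond_pos|].
  intros z Hz; apply Hd, C_NormedModule_mixin_compat1, Hz.
- intros [d [d0 Hd]].
  assert (h0 : 0 < d / sqrt 2) by (apply Rdiv_lt_0_compat; [easy|apply Rlt_sqrt2_0]).
  exists (mkposreal _ h0); intros z Hz; apply Hd.
  generalize (C_NormedModule_mixin_compat2 p z (mkposreal _ h0) Hz); simpl.
  replace (sqrt 2 * (d / sqrt 2)) with d; [easy|].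
  field; apply Rgt_not_eq, Rlt_sqrt2_0.
Qed.

Lemma continuous_Cmod (h : C -> C) (p : C) :
  continuous h p <->
  forall eps, 0 < eps -> locally p (fun z => Cmod (h z - h p) <= eps).
Proof.
split.
- intros H eps e0.
  assert (L : locally (h p) (fun y => Cmod (y - h p) <= eps))
    by (apply locally_Cmod; exists eps; split; [easy|]; intros; lra).
  exact (H _ L).
- intros H P HP.
  apply locally_Cmod in HP; destruct HP as [d [d0 Hd]].
  assert (e0 : 0 < d / 2) by lra.
  unfold filtermap; generalize (H _ e0); apply filter_imp.
  intros z Hz; apply Hd; lra.
Qed.

Lemma Cmod_sub_ge (x y : C) : Cmod x - Cmod y <= Cmod (x - y).
Proof.
generalize (Cmod_triangle (x - y) y); replace (x - y + y)%C with x by ring; lra.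
Qed.

Lemma Cmod_minus_sym (x y : C) : Cmod (x - y) = Cmod (y - x).
Proof. rewrite <- Cmod_opp; f_equal; ring. Qed.

Lemma Cmod_pair_le (x y : R) : Cmod (x, y) <= Rabs x + Rabs y.
Proof.
replace ((x, y) : C) with (RtoC x + Ci * RtoC y)%C
  by (apply injective_projections; simpl; ring).
eapply Rle_trans; [apply Cmod_triangle|].
rewrite Cmod_mult, Cmod_Ci, !Cmod_R; lra.
Qed.

Lemma im_le_Cmod (z : C) : Rabs (Im z) <= Cmod z.
Proof. eapply Rle_trans; [|apply Rmax_Cmod]; apply Rmax_r. Qed.

Lemma locally_bounded (h : C -> C) (p : C) :
  continuous h p -> locally p (fun z => Cmod (h z) <= Cmod (h p) + 1).
Proof.
intros H; generalize (proj1 (continuous_Cmod h p) H 1 Rlt_0_1).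
apply filter_imp; intros z Hz.
generalize (Cmod_sub_ge (h z) (h p)); lra.
Qed.

Lemma locally_small (p : C) (d : R) :
  0 < d -> locally p (fun z => Cmod (z - p) <= d).
Proof. intros d0; apply locally_Cmod; exists d; split; [easy|]; intros; lra. Qed.

Lemma continuous_Cplus (h k : C -> C) p :
  continuous h p -> continuous k p -> continuous (fun z => h z + k z)%C p.
Proof. intros; apply (continuous_plus (V := C_R_NormedModule) h k p); easy. Qed.

Lemma continuous_Copp (h : C -> C) p :
  continuous h p -> continuous (fun z => - h z)%C p.
Proof. intros; apply (continuous_opp (V := C_R_NormedModule) h p); easy. Qed.

Lemma continuous_Cminus (h k : C -> C) p :
  continuous h p -> continuous k p -> continuous (fun z => h z - k z)%C p.
Proof. intros; apply continuous_Cplus; [easy|now apply continuous_Copp]. Qed.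

Lemma continuous_Cconst (a p : C) : continuous (fun _ : C => a) p.
Proof. apply continuous_const. Qed.

Lemma continuous_Cmult (h k : C -> C) p :
  continuous h p -> continuous k p -> continuous (fun z => h z * k z)%C p.
Proof.
intros Hh Hk; apply continuous_Cmod; intros eps e0.
set (M := Cmod (h p) + Cmod (k p) + 1).
assert (M0 : 0 < M) by (unfold M; generalize (Cmod_ge_0 (h p)) (Cmod_ge_0 (k p)); lra).
assert (e1 : 0 < eps / (2 * M)) by (apply Rdiv_lt_0_compat; lra).
generalize (filter_and _ _ (locally_bounded _ _ Hk)
  (filter_and _ _ (proj1 (continuous_Cmod _ _) Hh _ e1)
     (proj1 (continuous_Cmod _ _) Hk _ e1))).
apply filter_imp; intros z (Hb & H1 & H2).
replace (h z * k z - h p * k p)%C with ((h z - h p) * k z + h p * (k z - k p))%C by ring.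
eapply Rle_trans; [apply Cmod_triangle|]; rewrite !Cmod_mult.
replace eps with (eps / (2 * M) * M + M * (eps / (2 * M))) by (field; lra).
generalize (Cmod_ge_0 (h p)) (Cmod_ge_0 (k p)); intros.
apply Rplus_le_compat; apply Rmult_le_compat; try apply Cmod_ge_0; try easy;
  unfold M; lra.
Qed.

Lemma locally_away (h : C -> C) (p : C) :
  continuous h p -> h p <> 0 -> locally p (fun z => Cmod (h p) / 2 <= Cmod (h z)).
Proof.
intros H H0; apply Cmod_gt_0 in H0.
assert (e0 : 0 < Cmod (h p) / 2) by lra.
generalize (proj1 (continuous_Cmod h p) H _ e0); apply filter_imp; intros z Hz.
rewrite Cmod_minus_sym in Hz; generalize (Cmod_sub_ge (h p) (h z)); lra.
Qed.

Lemma Cmod_pos_neq (z : C) : 0 < Cmod z -> z <> 0.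
Proof. apply Cmod_gt_0. Qed.

Lemma continuous_Cinv (h : C -> C) p :
  continuous h p -> h p <> 0 -> continuous (fun z => / h z)%C p.
Proof.
intros Hh H0; apply continuous_Cmod; intros eps e0.
generalize (proj1 (Cmod_gt_0 _) H0); intros m0.
assert (e1 : 0 < eps * (Cmod (h p) * (Cmod (h p) / 2))) by (repeat apply Rmult_lt_0_compat; lra).
generalize (filter_and _ _ (locally_away _ _ Hh H0) (proj1 (continuous_Cmod _ _) Hh _ e1)).
apply filter_imp; intros z (H1 & H2).
assert (m1 : 0 < Cmod (h z)) by lra.
assert (h z <> 0) by now apply Cmod_pos_neq.
replace (/ h z - / h p)%C with (- (h z - h p) / (h p * h z))%C by (field; easy).
rewrite Cmod_div, Cmod_mult, Cmod_opp by (now apply Cmult_neq_0).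
apply Rle_div_l; [now apply Rmult_lt_0_compat|].
eapply Rle_trans; [exact H2|].
apply Rmult_le_compat_l; [lra|]; apply Rmult_le_compat_l; lra.
Qed.

Lemma continuous_Cconj (h : C -> C) p :
  continuous h p -> continuous (fun z => Cconj (h z)) p.
Proof.
intros H; apply continuous_Cmod; intros eps e0.
generalize (proj1 (continuous_Cmod _ _) H _ e0); apply filter_imp; intros z Hz.
replace (Cconj (h z) - Cconj (h p))%C with (Cconj (h z - h p))
  by (apply injective_projections; simpl; ring).
now rewrite Cmod_conj.
Qed.

Lemma Csub_neq (z w : C) : z <> w -> (z - w)%C <> 0.
Proof. intros Hz E; apply Hz; replace z with (z - w + w)%C by ring; rewrite E; ring. Qed.

Lemma locally_neq (p q : C) : p <> q -> locally p (fun z => z <> q).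
Proof.
intros H; generalize (proj1 (Cmod_gt_0 _) (Csub_neq _ _ H)); intros D.
apply locally_Cmod; exists (Cmod (p - q)); split; [easy|]; intros z Hz ->.
rewrite Cmod_minus_sym in Hz; lra.
Qed.

(** [al] and [be] are the partial derivatives of [h] at [p] along the two axes,
    so that the d-bar derivative of [h] is [al + Ci * be]. *)
Definition Cdiff (h : C -> C) (p al be : C) : Prop :=
  forall eps, 0 < eps -> locally p (fun z =>
    Cmod (h z - h p - (al * RtoC (Re z - Re p) + be * RtoC (Im z - Im p)))
      <= eps * Cmod (z - p)).

Lemma Re_minus (z w : C) : Re (z - w) = Re z - Re w.
Proof. reflexivity. Qed.
Lemma Im_minus (z w : C) : Im (z - w) = Im z - Im w.
Proof. reflexivity. Qed.

Lemma linear_bound (al be z p : C) :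
  Cmod (al * RtoC (Re z - Re p) + be * RtoC (Im z - Im p))
    <= (Cmod al + Cmod be) * Cmod (z - p).
Proof.
eapply Rle_trans; [apply Cmod_triangle|]; rewrite !Cmod_mult, !Cmod_R.
rewrite Rmult_plus_distr_r, <- Re_minus, <- Im_minus.
apply Rplus_le_compat; apply Rmult_le_compat_l; try apply Cmod_ge_0;
  [apply re_le_Cmod|apply im_le_Cmod].
Qed.

Lemma Cdiff_lipschitz h p al be : Cdiff h p al be ->
  locally p (fun z => Cmod (h z - h p) <= (Cmod al + Cmod be + 1) * Cmod (z - p)).
Proof.
intros H; generalize (H 1 Rlt_0_1); apply filter_imp; intros z Hz.
generalize (linear_bound al be z p) (Cmod_sub_ge (h z - h p) (al * RtoC (Re z - Re p) + be * RtoC (Im z - Im p))); lra.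
Qed.

Lemma Cdiff_continuous h p al be : Cdiff h p al be -> continuous h p.
Proof.
intros H; apply continuous_Cmod; intros eps e0.
set (M := Cmod al + Cmod be + 1).
assert (M0 : 0 < M) by (unfold M; generalize (Cmod_ge_0 al) (Cmod_ge_0 be); lra).
generalize (filter_and _ _ (Cdiff_lipschitz _ _ _ _ H)
   (locally_small p (eps / M) (Rdiv_lt_0_compat _ _ e0 M0))).
apply filter_imp; intros z [H1 H2]; fold M in H1.
apply (Rle_trans _ _ _ H1).
replace eps with (M * (eps / M)) by (field; lra).
apply Rmult_le_compat_l; lra.
Qed.

Lemma Cdiff_ext h k p al be :
  locally p (fun z => h z = k z) -> Cdiff h p al be -> Cdiff k p al be.
Proof.
intros E H eps e0.
generalize (locally_singleton _ _ E); intros E0.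
generalize (filter_and _ _ E (H eps e0)); apply filter_imp; intros z [E1 H1].
now rewrite <- E1, <- E0.
Qed.

Lemma Cdiff_eq h p al be al' be' :
  Cdiff h p al be -> al = al' -> be = be' -> Cdiff h p al' be'.
Proof. now intros H <- <-. Qed.

Lemma Cdiff_const (a p : C) : Cdiff (fun _ => a) p 0 0.
Proof.
intros eps e0; apply filter_forall; intros z.
replace (a - a - _)%C with (RtoC 0) by ring; rewrite Cmod_0.
apply Rmult_le_pos; [lra|apply Cmod_ge_0].
Qed.

Lemma C_split (z : C) : z = (RtoC (Re z) + Ci * RtoC (Im z))%C.
Proof. apply injective_projections; simpl; unfold Re, Im; ring. Qed.

Lemma Cdiff_id (p : C) : Cdiff (fun z => z) p 1 Ci.
Proof.
intros eps e0; apply filter_forall; intros z.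
replace (z - p - _)%C with (RtoC 0).
- rewrite Cmod_0; apply Rmult_le_pos; [lra|apply Cmod_ge_0].
- apply injective_projections; simpl; unfold Re, Im; ring.
Qed.

Lemma Cdiff_plus h k p a1 b1 a2 b2 :
  Cdiff h p a1 b1 -> Cdiff k p a2 b2 ->
  Cdiff (fun z => h z + k z)%C p (a1 + a2) (b1 + b2).
Proof.
intros H K eps e0; assert (e1 : 0 < eps / 2) by lra.
generalize (filter_and _ _ (H _ e1) (K _ e1)); apply filter_imp; intros z [H1 H2].
match goal with |- Cmod ?x <= _ => replace x with
  ((h z - h p - (a1 * RtoC (Re z - Re p) + b1 * RtoC (Im z - Im p))) +
   (k z - k p - (a2 * RtoC (Re z - Re p) + b2 * RtoC (Im z - Im p))))%C by ring end.
eapply Rle_trans; [apply Cmod_triangle|]; lra.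
Qed.

Lemma Cdiff_mult h k p a1 b1 a2 b2 :
  Cdiff h p a1 b1 -> Cdiff k p a2 b2 ->
  Cdiff (fun z => h z * k z)%C p (a1 * k p + h p * a2) (b1 * k p + h p * b2).
Proof.
intros H K eps e0.
set (M := Cmod (h p) + Cmod (k p) + Cmod a1 + Cmod b1 + 1).
generalize (Cmod_ge_0 (h p)) (Cmod_ge_0 (k p)) (Cmod_ge_0 a1) (Cmod_ge_0 b1); intros.
assert (M0 : 0 < M) by (unfold M; lra).
assert (e1 : 0 < eps / (3 * M)) by (apply Rdiv_lt_0_compat; lra).
generalize (Cdiff_continuous _ _ _ _ K); intros Kc.
generalize (filter_and _ _ (filter_and _ _ (H _ e1) (K _ e1)) (filter_and _ _
  (locally_bounded _ _ Kc) (proj1 (continuous_Cmod _ _) Kc _ e1))).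
apply filter_imp; intros z [[E1 E2] [E3 E4]].
generalize (linear_bound a1 b1 z p).
set (L := (a1 * RtoC (Re z - Re p) + b1 * RtoC (Im z - Im p))%C) in *.
set (L' := (a2 * RtoC (Re z - Re p) + b2 * RtoC (Im z - Im p))%C) in *.
intros E5.
match goal with |- Cmod ?x <= _ => replace x with
  ((h z - h p - L) * k z + h p * (k z - k p - L') + L * (k z - k p))%C
  by (unfold L, L'; ring) end.
eapply Rle_trans; [apply Cmod_triangle|].
eapply Rle_trans; [apply Rplus_le_compat_r, Cmod_triangle|]; rewrite !Cmod_mult.
set (r := Cmod (z - p)) in *; assert (0 <= r) by apply Cmod_ge_0.
replace (eps * r) with ((eps / (3 * M) * r) * M + M * (eps / (3 * M) * r) + (M * r) * (eps / (3 * M)))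
  by (field; lra).
assert (0 <= eps / (3 * M) * r) by (apply Rmult_le_pos; lra).
repeat apply Rplus_le_compat; apply Rmult_le_compat; try apply Cmod_ge_0; try easy; try (unfold M; lra).
apply (Rle_trans _ _ _ E5), Rmult_le_compat_r; unfold M; lra.
Qed.

Lemma Cdiff_conj h p al be :
  Cdiff h p al be -> Cdiff (fun z => Cconj (h z)) p (Cconj al) (Cconj be).
Proof.
intros H eps e0; generalize (H _ e0); apply filter_imp; intros z Hz.
rewrite <- Cmod_conj in Hz; eapply Rle_trans; [|exact Hz]; right; f_equal.
apply injective_projections; simpl; ring.
Qed.

Lemma Cdiff_inv h p al be :
  Cdiff h p al be -> h p <> 0 ->
  Cdiff (fun z => / h z)%C p (- al / (h p * h p)) (- be / (h p * h p)).
Proof.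
intros H H0 eps e0.
generalize (Cdiff_continuous _ _ _ _ H); intros Hc.
generalize (proj1 (Cmod_gt_0 _) H0); intros m0.
set (m := Cmod (h p)) in *.
set (M := m + Cmod al + Cmod be + 1).
generalize (Cmod_ge_0 al) (Cmod_ge_0 be); intros.
assert (M0 : 0 < M) by (unfold M; lra).
set (e := eps * (m * m * (m / 2)) / (2 * M)).
assert (e1 : 0 < e) by (unfold e; apply Rdiv_lt_0_compat; [|lra]; repeat apply Rmult_lt_0_compat; lra).
generalize (filter_and _ _ (locally_away _ _ Hc H0)
  (filter_and _ _ (H _ e1) (proj1 (continuous_Cmod _ _) Hc _ e1))).
apply filter_imp; intros z (E1 & E2 & E3); fold m in E1.
assert (hz : h z <> 0) by (apply Cmod_pos_neq; lra).
generalize (linear_bound al be z p).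
set (L := (al * RtoC (Re z - Re p) + be * RtoC (Im z - Im p))%C) in *; intros E5.
match goal with |- Cmod ?x <= _ => replace x with
  ((- (h p * (h z - h p - L)) + L * (h z - h p)) / (h p * h p * h z))%C
  by (unfold L; field; easy) end.
rewrite Cmod_div, !Cmod_mult by (repeat apply Cmult_neq_0; easy); fold m.
assert (0 < m * m * Cmod (h z)) by (repeat apply Rmult_lt_0_compat; lra).
apply Rle_div_l; [easy|].
eapply Rle_trans; [apply Cmod_triangle|]; rewrite Cmod_opp, !Cmod_mult; fold m.
set (r := Cmod (z - p)) in *; assert (0 <= r) by apply Cmod_ge_0.
apply Rle_trans with (M * (e * r) + (M * r) * e).
- apply Rplus_le_compat; apply Rmult_le_compat; try apply Cmod_ge_0; try easy; try (unfold M; lra).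
  apply (Rle_trans _ _ _ E5), Rmult_le_compat_r; unfold M; lra.
- replace (M * (e * r) + M * r * e) with (eps * r * (m * m * (m / 2)))
    by (unfold e; field; lra).
  apply Rmult_le_compat_l; [apply Rmult_le_pos; lra|].
  apply Rmult_le_compat_l; [apply Rmult_le_pos; lra|lra].
Qed.

(** * Contour integrals over rectangles *)
Definition CInt (h : R -> C) (a b : R) : C := RInt (V := C_R_CompleteNormedModule) h a b.

Lemma CInt_unique (h : R -> C) a b (I : C) :
  is_RInt (V := C_R_NormedModule) h a b I -> CInt h a b = I.
Proof. exact (is_RInt_unique (V := C_R_CompleteNormedModule) h a b I). Qed.

Lemma CInt_correct (h : R -> C) a b :
  ex_RInt (V := C_R_NormedModule) h a b -> is_RInt (V := C_R_NormedModule) h a b (CInt h a b).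
Proof. exact (RInt_correct (V := C_R_CompleteNormedModule) h a b). Qed.

Lemma CInt_ext (h k : R -> C) a b : a <= b ->
  (forall x, a <= x <= b -> h x = k x) -> CInt h a b = CInt k a b.
Proof.
intros ab E; apply (RInt_ext (V := C_R_CompleteNormedModule)).
rewrite Rmin_left, Rmax_right by easy; intros x Hx; apply E; lra.
Qed.

Lemma CInt_Chasles (h : R -> C) a b c :
  ex_RInt (V := C_R_NormedModule) h a b -> ex_RInt (V := C_R_NormedModule) h b c ->
  (CInt h a b + CInt h b c)%C = CInt h a c.
Proof. exact (RInt_Chasles (V := C_R_CompleteNormedModule) h a b c). Qed.

Lemma CInt_plus (h k : R -> C) a b :
  ex_RInt (V := C_R_NormedModule) h a b -> ex_RInt (V := C_R_NormedModule) k a b ->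
  CInt (fun x => h x + k x)%C a b = (CInt h a b + CInt k a b)%C.
Proof. exact (RInt_plus (V := C_R_CompleteNormedModule) h k a b). Qed.

Lemma CInt_bound (h : R -> C) a b M : a <= b ->
  ex_RInt (V := C_R_NormedModule) h a b ->
  (forall x, a <= x <= b -> Cmod (h x) <= M) -> Cmod (CInt h a b) <= (b - a) * M.
Proof.
intros ab Hex HM; rewrite Cmod_norm.
apply (norm_RInt_le_const (V := C_R_NormedModule) h a b); [easy| |now apply CInt_correct].
intros x Hx; apply (Rle_trans _ (Cmod (h x))); [right; symmetry; exact (Cmod_norm (h x))|].
now apply HM.
Qed.

Definition rect_int (h : C -> C) (a b c d : R) : C :=
  (CInt (fun x => h (x, c)) a b + Ci * CInt (fun y => h (b, y)) c d
   - CInt (fun x => h (x, d)) a b - Ci * CInt (fun y => h (a, y)) c d)%C.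

Definition box (a b c d : R) (z : C) : Prop := a <= Re z <= b /\ c <= Im z <= d.

(** The contour integral only sees the boundary, and the integrands with a pole
    are continuous there but not inside: hypotheses are put on the frame. *)
Definition frame (a b c d : R) (z : C) : Prop :=
  box a b c d z /\ (Re z = a \/ Re z = b \/ Im z = c \/ Im z = d).

Lemma continuous_hor (h : C -> C) x y :
  continuous h (x, y) ->
  continuous (T := R_UniformSpace) (U := C_R_NormedModule) (fun s => h (s, y)) x.
Proof.
intros H; apply (continuous_comp_2 (fun s => s) (fun _ => y) (fun s t => h (s, t))).
- apply continuous_id.
- apply continuous_const.
- now apply continuous_ext with h; [intros []|].
Qed.

Lemma continuous_ver (h : C -> C) x y :
  continuous h (x, y) ->
  continuous (T := R_UniformSpace) (U := C_R_NormedModule) (fun t => h (x, t)) y.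
Proof.
intros H; apply (continuous_comp_2 (fun _ => x) (fun t => t) (fun s t => h (s, t))).
- apply continuous_const.
- apply continuous_id.
- now apply continuous_ext with h; [intros []|].
Qed.

Definition cont_frame (h : C -> C) (a b c d : R) : Prop :=
  forall z, frame a b c d z -> continuous h z.

Lemma ex_RInt_hor h a b c d y a' b' : cont_frame h a b c d -> c <= d ->
  y = c \/ y = d -> a <= a' -> a' <= b' -> b' <= b ->
  ex_RInt (V := C_R_NormedModule) (fun x => h (x, y)) a' b'.
Proof.
intros H cd E ? ? ?; apply (@ex_RInt_continuous C_R_CompleteNormedModule); intros x Hx.
rewrite Rmin_left, Rmax_right in Hx by easy.
apply continuous_hor, H; split; [split; simpl; intuition lra|]; simpl; intuition.
Qed.

Lemma ex_RInt_ver h a b c d x c' d' : cont_frame h a b c d -> a <= b ->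
  x = a \/ x = b -> c <= c' -> c' <= d' -> d' <= d ->
  ex_RInt (V := C_R_NormedModule) (fun y => h (x, y)) c' d'.
Proof.
intros H ab E ? ? ?; apply (@ex_RInt_continuous C_R_CompleteNormedModule); intros y Hy.
rewrite Rmin_left, Rmax_right in Hy by easy.
apply continuous_ver, H; split; [split; simpl; intuition lra|]; simpl; intuition.
Qed.

Ltac horizontal H := apply (ex_RInt_hor _ _ _ _ _ _ _ _ H); intuition lra.
Ltac vertical H := apply (ex_RInt_ver _ _ _ _ _ _ _ _ H); intuition lra.

Lemma rect_split_v h a b c d m : a <= m <= b -> c <= d -> cont_frame h a b c d ->
  rect_int h a b c d = (rect_int h a m c d + rect_int h m b c d)%C.
Proof.
intros Hm cd H; unfold rect_int.
rewrite <- (CInt_Chasles (fun x => h (x, c)) a m b) by horizontal H.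
rewrite <- (CInt_Chasles (fun x => h (x, d)) a m b) by horizontal H.
ring.
Qed.

Lemma rect_split_h h a b c d m : c <= m <= d -> a <= b -> cont_frame h a b c d ->
  rect_int h a b c d = (rect_int h a b c m + rect_int h a b m d)%C.
Proof.
intros Hm ab H; unfold rect_int.
rewrite <- (CInt_Chasles (fun y => h (a, y)) c m d) by vertical H.
rewrite <- (CInt_Chasles (fun y => h (b, y)) c m d) by vertical H.
ring.
Qed.

Lemma ex_RInt_frame h a b c d : a <= b -> c <= d -> cont_frame h a b c d ->
  ex_RInt (V := C_R_NormedModule) (fun x => h (x, c)) a b /\
  ex_RInt (V := C_R_NormedModule) (fun x => h (x, d)) a b /\
  ex_RInt (V := C_R_NormedModule) (fun y => h (a, y)) c d /\
  ex_RInt (V := C_R_NormedModule) (fun y => h (b, y)) c d.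
Proof. intros ab cd H; split; [horizontal H|split; [horizontal H|split; vertical H]]. Qed.

Lemma rect_bound h a b c d M : a <= b -> c <= d -> cont_frame h a b c d ->
  (forall z, frame a b c d z -> Cmod (h z) <= M) ->
  Cmod (rect_int h a b c d) <= 2 * M * ((b - a) + (d - c)).
Proof.
intros ab cd H HM.
assert (Hh : forall y, y = c \/ y = d -> Cmod (CInt (fun x => h (x, y)) a b) <= (b - a) * M).
{ intros y Hy; apply CInt_bound; [easy|horizontal H|].
  intros x Hx; apply HM; split; [split; simpl; destruct Hy; lra|]; simpl; intuition. }
assert (Hv : forall x, x = a \/ x = b -> Cmod (CInt (fun y => h (x, y)) c d) <= (d - c) * M).
{ intros x Hx; apply CInt_bound; [easy|vertical H|].
  intros y Hy; apply HM; split; [split; simpl; destruct Hx; lra|]; simpl; intuition. }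
unfold rect_int, Cminus.
eapply Rle_trans; [apply Cmod_triangle|].
eapply Rle_trans; [apply Rplus_le_compat_r, Cmod_triangle|].
eapply Rle_trans; [apply Rplus_le_compat_r, Rplus_le_compat_r, Cmod_triangle|].
rewrite !Cmod_opp, !Cmod_mult, Cmod_Ci.
generalize (Hh c (or_introl eq_refl)) (Hh d (or_intror eq_refl))
  (Hv a (or_introl eq_refl)) (Hv b (or_intror eq_refl)); lra.
Qed.

Lemma rect_ext h k a b c d : a <= b -> c <= d ->
  (forall z, frame a b c d z -> h z = k z) ->
  rect_int h a b c d = rect_int k a b c d.
Proof.
intros ab cd E; unfold rect_int.
assert (Eh : forall y, y = c \/ y = d -> CInt (fun x => h (x, y)) a b = CInt (fun x => k (x, y)) a b).
{ intros y Hy; apply CInt_ext; [easy|]; intros x Hx.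
  apply E; split; [split; simpl; destruct Hy; lra|]; simpl; intuition. }
assert (Ev : forall x, x = a \/ x = b -> CInt (fun y => h (x, y)) c d = CInt (fun y => k (x, y)) c d).
{ intros x Hx; apply CInt_ext; [easy|]; intros y Hy.
  apply E; split; [split; simpl; destruct Hx; lra|]; simpl; intuition. }
rewrite !Eh, !Ev by intuition; easy.
Qed.

Lemma rect_plus h k a b c d : a <= b -> c <= d ->
  cont_frame h a b c d -> cont_frame k a b c d ->
  rect_int (fun z => h z + k z)%C a b c d = (rect_int h a b c d + rect_int k a b c d)%C.
Proof.
intros ab cd Hh Hk; destruct (ex_RInt_frame _ _ _ _ _ ab cd Hh) as (h1 & h2 & h3 & h4).
destruct (ex_RInt_frame _ _ _ _ _ ab cd Hk) as (k1 & k2 & k3 & k4).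
unfold rect_int; rewrite (CInt_plus _ _ _ _ h1 k1), (CInt_plus _ _ _ _ h2 k2),
  (CInt_plus _ _ _ _ h3 k3), (CInt_plus _ _ _ _ h4 k4); ring.
Qed.

Lemma CInt_Cmult_l (al : C) (h : R -> C) a b :
  ex_RInt (V := C_R_NormedModule) h a b ->
  CInt (fun x => al * h x)%C a b = (al * CInt h a b)%C.
Proof.
intros [I HI].
rewrite (CInt_unique _ _ _ _ HI).
apply CInt_unique.
generalize (is_RInt_fct_extend_fst _ _ _ _ HI) (is_RInt_fct_extend_snd _ _ _ _ HI); intros H1 H2.
apply is_RInt_fct_extend_pair; simpl.
- apply (is_RInt_minus (V := R_NormedModule) (fun t => fst al * fst (h t)) (fun t => snd al * snd (h t)) _ _ (fst al * fst I) (snd al * snd I));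
  apply (is_RInt_scal (V := R_NormedModule)); assumption.
- apply (is_RInt_plus (V := R_NormedModule) (fun t => fst al * snd (h t)) (fun t => snd al * fst (h t)) _ _ (fst al * snd I) (snd al * fst I));
  apply (is_RInt_scal (V := R_NormedModule)); assumption.
Qed.

Lemma CInt_conj (h : R -> C) a b :
  ex_RInt (V := C_R_NormedModule) h a b ->
  CInt (fun x => Cconj (h x)) a b = Cconj (CInt h a b).
Proof.
intros [I HI].
rewrite (CInt_unique _ _ _ _ HI).
apply CInt_unique.
generalize (is_RInt_fct_extend_fst _ _ _ _ HI) (is_RInt_fct_extend_snd _ _ _ _ HI); intros H1 H2.
apply is_RInt_fct_extend_pair; simpl.
- exact H1.
- apply (is_RInt_opp (V := R_NormedModule)); assumption.
Qed.

Lemma rect_scal al h a b c d : a <= b -> c <= d ->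
  cont_frame h a b c d ->
  rect_int (fun z => al * h z)%C a b c d = (al * rect_int h a b c d)%C.
Proof.
intros ab cd Hh; destruct (ex_RInt_frame _ _ _ _ _ ab cd Hh) as (h1 & h2 & h3 & h4).
unfold rect_int; rewrite (CInt_Cmult_l al _ _ _ h1), (CInt_Cmult_l al _ _ _ h2),
  (CInt_Cmult_l al _ _ _ h3), (CInt_Cmult_l al _ _ _ h4); ring.
Qed.

Lemma rect_minus h k a b c d : a <= b -> c <= d ->
  cont_frame h a b c d -> cont_frame k a b c d ->
  rect_int (fun z => h z - k z)%C a b c d = (rect_int h a b c d - rect_int k a b c d)%C.
Proof.
intros ab cd Hh Hk.
rewrite (rect_ext _ (fun z => h z + (-(1)) * k z)%C) by (try easy; intros; ring).
rewrite rect_plus, rect_scal; try easy; [ring|].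
intros z Hz; apply continuous_Cmult; [apply continuous_Cconst|now apply Hk].
Qed.

Lemma CInt_derive (F f : R -> C) a b : a <= b ->
  (forall x, a <= x <= b -> is_derive (fun t => Re (F t)) x (Re (f x))) ->
  (forall x, a <= x <= b -> is_derive (fun t => Im (F t)) x (Im (f x))) ->
  (forall x, a <= x <= b -> continuous (U := C_R_NormedModule) f x) ->
  CInt f a b = (F b - F a)%C.
Proof.
intros ab D1 D2 Hc; apply CInt_unique.
apply (is_RInt_fct_extend_pair (U := R_NormedModule) (V := R_NormedModule)).
- apply (is_RInt_derive (V := R_CompleteNormedModule) (fun t => Re (F t)));
    rewrite Rmin_left, Rmax_right by easy; intros x Hx; [now apply D1|].
  apply (continuous_comp f fst); [now apply Hc|apply continuous_fst].
- apply (is_RInt_derive (V := R_CompleteNormedModule) (fun t => Im (F t)));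
    rewrite Rmin_left, Rmax_right by easy; intros x Hx; [now apply D2|].
  apply (continuous_comp f snd); [now apply Hc|apply continuous_snd].
Qed.

Lemma continuous_affine (A al be : C) p :
  continuous (fun z => A + (al * RtoC (Re z) + be * RtoC (Im z)))%C p.
Proof.
apply (Cdiff_continuous _ _ al be).
intros eps e0; apply filter_forall; intros z.
replace (_ - _ - _)%C with (RtoC 0); [rewrite Cmod_0; apply Rmult_le_pos; [lra|apply Cmod_ge_0]|].
rewrite !RtoC_minus; ring.
Qed.

(** Green's formula for affine functions, by direct computation; it is the only
    case needed, because every other integrand is compared with its first-order
    expansion. *)
Lemma rect_affine (A al be : C) a b c d : a <= b -> c <= d ->
  rect_int (fun z => A + (al * RtoC (Re z) + be * RtoC (Im z)))%C a b c d
   = (Ci * (al + Ci * be) * RtoC ((b - a) * (d - c)))%C.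
Proof.
intros ab cd; unfold rect_int.
assert (Hh : forall y, CInt (fun x => A + (al * RtoC (Re (x, y)) + be * RtoC (Im (x, y))))%C a b
  = ((A + be * RtoC y) * RtoC (b - a) + al * RtoC ((b ^ 2 - a ^ 2) / 2))%C).
{ intros y.
  rewrite (CInt_derive (fun x => (A + be * RtoC y) * RtoC x + al * RtoC (x ^ 2 / 2))%C).
  - apply injective_projections; simpl; field.
  - easy.
  - intros x _; simpl; auto_derive; [easy|simpl; field].
  - intros x _; simpl; auto_derive; [easy|simpl; field].
  - intros x _; apply (continuous_hor (fun z => A + (al * RtoC (Re z) + be * RtoC (Im z)))%C).
    apply continuous_affine. }
assert (Hv : forall x, CInt (fun y => A + (al * RtoC (Re (x, y)) + be * RtoC (Im (x, y))))%C c d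
  = ((A + al * RtoC x) * RtoC (d - c) + be * RtoC ((d ^ 2 - c ^ 2) / 2))%C).
{ intros x.
  rewrite (CInt_derive (fun y => (A + al * RtoC x) * RtoC y + be * RtoC (y ^ 2 / 2))%C).
  - apply injective_projections; simpl; field.
  - easy.
  - intros y _; simpl; auto_derive; [easy|simpl; field].
  - intros y _; simpl; auto_derive; [easy|simpl; field].
  - intros y _; apply (continuous_ver (fun z => A + (al * RtoC (Re z) + be * RtoC (Im z)))%C).
    apply continuous_affine. }
rewrite !Hh, !Hv.
apply injective_projections; simpl; field.
Qed.

(** * The areolar derivative *)

(** Pompeiu's areolar derivative: [g] is the limit of the contour integral of [h]
    divided by [Ci] times the area, over rectangles shrinking to [p].  It makes
    sense for a merely continuous [h], which is what allows derivatives of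
    functions not yet known to be differentiable.  The error is measured by the
    square of the half-perimeter, not by the area, so that thin rectangles need
    no special treatment. *)
Definition has_dbar (h : C -> C) (p g : C) : Prop :=
  locally p (continuous h) /\
  forall eps, 0 < eps -> exists del, 0 < del /\
    forall a b c d, box a b c d p -> (b - a) + (d - c) < del ->
      Cmod (rect_int h a b c d - Ci * g * RtoC ((b - a) * (d - c)))
        <= eps * ((b - a) + (d - c)) ^ 2.

Lemma box_dist a b c d p z :
  box a b c d p -> box a b c d z -> Cmod (z - p) <= (b - a) + (d - c).
Proof.
intros [H1 H2] [H3 H4].
replace (z - p)%C with ((Re z - Re p, Im z - Im p) : C) by (apply injective_projections; simpl; unfold Re, Im; ring).
eapply Rle_trans; [apply Cmod_pair_le|].
apply Rplus_le_compat; apply Rabs_le; lra.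
Qed.

Lemma box_order a b c d p : box a b c d p -> a <= b /\ c <= d.
Proof. intros [? ?]; lra. Qed.

Lemma locally_box p P : locally p P -> exists del, 0 < del /\
  forall a b c d, box a b c d p -> (b - a) + (d - c) < del ->
    forall z, box a b c d z -> P z.
Proof.
intros H; apply locally_Cmod in H; destruct H as [del [d0 Hd]].
exists del; split; [easy|]; intros a b c d Hp Hs z Hz.
apply Hd; generalize (box_dist _ _ _ _ _ _ Hp Hz); lra.
Qed.

Lemma has_dbar_continuous h p g : has_dbar h p g -> continuous h p.
Proof. intros [H _]; exact (locally_singleton _ _ H). Qed.

Lemma has_dbar_intro h p g :
  locally p (continuous h) ->
  (forall eps, 0 < eps -> exists del, 0 < del /\
    forall a b c d, a <= b -> c <= d -> box a b c d p -> (b - a) + (d - c) < del ->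
      (forall z, box a b c d z -> continuous h z) ->
      Cmod (rect_int h a b c d - Ci * g * RtoC ((b - a) * (d - c)))
        <= eps * ((b - a) + (d - c)) ^ 2) ->
  has_dbar h p g.
Proof.
intros Hc H; split; [easy|]; intros eps e0.
destruct (H eps e0) as [d1 [d1p H1]].
destruct (locally_box _ _ Hc) as [d2 [d2p H2]].
exists (Rmin d1 d2); split; [now apply Rmin_glb_lt|].
intros a b c d Hp Hs; destruct (box_order _ _ _ _ _ Hp).
generalize (Rmin_l d1 d2) (Rmin_r d1 d2); intros.
apply H1; try easy; [lra|]; apply H2; [easy|lra].
Qed.

Lemma has_dbar_ext h k p g :
  locally p (fun z => h z = k z) -> has_dbar h p g -> has_dbar k p g.
Proof.
intros E [Hc H]; apply has_dbar_intro.
- generalize (filter_and _ _ (locally_locally _ _ E) Hc); apply filter_imp.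
  intros z [H1 H2]; now apply (continuous_ext_loc _ h).
- intros eps e0; destruct (H eps e0) as [d1 [d1p H1]].
  destruct (locally_box _ _ E) as [d2 [d2p H2]].
  exists (Rmin d1 d2); split; [now apply Rmin_glb_lt|].
  generalize (Rmin_l d1 d2) (Rmin_r d1 d2); intros.
  rewrite <- (rect_ext h k); try easy; [apply H1; [easy|lra]|].
  intros z [Hz _]; eapply H2; try eassumption; lra.
Qed.

Lemma has_dbar_eq h p g g' : has_dbar h p g -> g = g' -> has_dbar h p g'.
Proof. now intros H <-. Qed.

Lemma has_dbar_plus h k p g l :
  has_dbar h p g -> has_dbar k p l -> has_dbar (fun z => h z + k z)%C p (g + l).
Proof.
intros [Hc H] [Kc K].
assert (L : locally p (fun z => continuous h z /\ continuous k z)) by now apply filter_and.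
apply has_dbar_intro.
- revert L; apply filter_imp; intros z []; now apply continuous_Cplus.
- intros eps e0; assert (e1 : 0 < eps / 2) by lra.
  destruct (H _ e1) as [d1 [d1p H1]]; destruct (K _ e1) as [d2 [d2p H2]].
  destruct (locally_box _ _ L) as [d3 [d3p H3]].
  exists (Rmin d1 (Rmin d2 d3)); split; [now repeat apply Rmin_glb_lt|].
  intros a b c d ab cd Hp Hs _.
  generalize (Rmin_l d1 (Rmin d2 d3)) (Rmin_r d1 (Rmin d2 d3)) (Rmin_l d2 d3) (Rmin_r d2 d3); intros.
  specialize (H1 _ _ _ _ Hp ltac:(lra)); specialize (H2 _ _ _ _ Hp ltac:(lra)).
  specialize (H3 _ _ _ _ Hp ltac:(lra)).
  rewrite rect_plus; try easy; try (intros z [Hz _]; now apply H3).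
  match goal with |- Cmod ?x <= _ => replace x with
   ((rect_int h a b c d - Ci * g * RtoC ((b - a) * (d - c))) +
    (rect_int k a b c d - Ci * l * RtoC ((b - a) * (d - c))))%C by ring end.
  eapply Rle_trans; [apply Cmod_triangle|]; lra.
Qed.

Lemma has_dbar_scal al h p g :
  has_dbar h p g -> has_dbar (fun z => al * h z)%C p (al * g).
Proof.
intros [Hc H].
apply has_dbar_intro.
- revert Hc; apply filter_imp; intros z ?; apply continuous_Cmult; [apply continuous_Cconst|easy].
- intros eps e0; assert (m0 := Cmod_ge_0 al).
  assert (e1 : 0 < eps / (Cmod al + 1)) by (apply Rdiv_lt_0_compat; lra).
  destruct (H _ e1) as [d1 [d1p H1]].
  destruct (locally_box _ _ Hc) as [d3 [d3p H3]].
  exists (Rmin d1 d3); split; [now repeat apply Rmin_glb_lt|].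
  intros a b c d ab cd Hp Hs _.
  generalize (Rmin_l d1 d3) (Rmin_r d1 d3); intros.
  specialize (H1 _ _ _ _ Hp ltac:(lra)); specialize (H3 _ _ _ _ Hp ltac:(lra)).
  rewrite rect_scal; try easy; try (intros z [Hz _]; now apply H3).
  match goal with |- Cmod ?x <= _ => replace x with
   (al * (rect_int h a b c d - Ci * g * RtoC ((b - a) * (d - c))))%C by ring end.
  rewrite Cmod_mult.
  set (s := (_ + _) ^ 2) in *.
  apply Rle_trans with ((Cmod al + 1) * (eps / (Cmod al + 1) * s)); [|right; field; lra].
  apply Rmult_le_compat; try apply Cmod_ge_0; lra.
Qed.

Lemma rect_bound_o h a b c d p eps : a <= b -> c <= d -> 0 <= eps -> box a b c d p ->
  (forall z, box a b c d z -> continuous h z) ->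
  (forall z, box a b c d z -> Cmod (h z) <= eps * Cmod (z - p)) ->
  Cmod (rect_int h a b c d) <= 2 * eps * ((b - a) + (d - c)) ^ 2.
Proof.
intros ab cd e0 Hp Hc H.
set (s := b - a + (d - c)); assert (0 <= s) by (unfold s; lra).
apply Rle_trans with (2 * (eps * s) * s); [|right; ring].
apply rect_bound; try easy.
- intros z [Hz _]; now apply Hc.
- intros z [Hz _]; eapply Rle_trans; [now apply H|].
  apply Rmult_le_compat_l; [easy|]; now apply box_dist.
Qed.

(** Replace [h] by its affine part: the remainder is [o] of the distance, and is
    integrated over a perimeter of the same order. *)
Lemma has_dbar_Cdiff h p al be :
  locally p (continuous h) -> Cdiff h p al be -> has_dbar h p (al + Ci * be).
Proof.
intros Hc H; apply has_dbar_intro; [easy|]; intros eps e0.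
assert (e1 : 0 < eps / 2) by lra.
destruct (locally_box _ _ (H _ e1)) as [del [d0 Hd]].
exists del; split; [easy|]; intros a b c d ab cd Hp Hs HC.
set (A := (h p - (al * RtoC (Re p) + be * RtoC (Im p)))%C).
rewrite <- (rect_affine A al be a b c d) by easy.
assert (cA : cont_frame (fun z => A + (al * RtoC (Re z) + be * RtoC (Im z)))%C a b c d)
  by (intros z _; apply continuous_affine).
rewrite <- rect_minus; try easy; [|intros z [Hz _]; now apply HC].
replace eps with (2 * (eps / 2)) by field.
apply rect_bound_o with p; try easy; try lra.
- intros z Hz; apply continuous_Cminus; [now apply HC|apply continuous_affine].
- intros z Hz; eapply Rle_trans; [|apply (Hd _ _ _ _ Hp Hs _ Hz)]; right; f_equal.
  unfold A; rewrite !RtoC_minus; ring.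
Qed.

(** Leibniz rule when only one factor is differentiable.  The product
    [(h - h p) * (k - k p)] is small because [k - k p] is of first order and
    [h - h p] tends to 0; what is left of [h * k] is a combination of [h], [k]
    and a constant. *)
Lemma has_dbar_mult h k p g al be :
  has_dbar h p g -> locally p (continuous k) -> Cdiff k p al be ->
  has_dbar (fun z => h z * k z)%C p (g * k p + h p * (al + Ci * be)).
Proof.
intros Hh Kc K.
generalize (has_dbar_scal (k p) _ _ _ Hh) (has_dbar_scal (h p) _ _ _ (has_dbar_Cdiff _ _ _ _ Kc K)).
intros D1 D2; generalize (has_dbar_plus _ _ _ _ _ D1 D2); clear D1 D2; intros D.
generalize (filter_and _ _ (proj1 Hh) Kc); intros L.
apply has_dbar_intro.
- revert L; apply filter_imp; intros z []; now apply continuous_Cmult.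
- intros eps e0.
  assert (e2 : 0 < eps / 2) by lra.
  destruct (proj2 D _ e2) as [d1 [d1p H1]].
  set (M := Cmod al + Cmod be + 1).
  assert (M0 : 0 < M) by (unfold M; generalize (Cmod_ge_0 al) (Cmod_ge_0 be); lra).
  assert (e1 : 0 < eps / (4 * M)) by (apply Rdiv_lt_0_compat; lra).
  destruct (locally_box _ _ (filter_and _ _ L (filter_and _ _ (Cdiff_lipschitz _ _ _ _ K)
    (proj1 (continuous_Cmod _ _) (has_dbar_continuous _ _ _ Hh) _ e1)))) as [d2 [d2p H2]].
  exists (Rmin d1 d2); split; [now apply Rmin_glb_lt|].
  intros a b c d ab cd Hp Hs _.
  generalize (Rmin_l d1 d2) (Rmin_r d1 d2); intros.
  specialize (H1 _ _ _ _ Hp ltac:(lra)); specialize (H2 _ _ _ _ Hp ltac:(lra)).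
  assert (c1 : forall z, box a b c d z -> continuous (fun z => (h z - h p) * (k z - k p) )%C z).
  { intros z Hz; destruct (H2 _ Hz) as [[] _].
    apply continuous_Cmult; apply continuous_Cminus; try easy; apply continuous_Cconst. }
  assert (c2 : forall z, box a b c d z -> continuous (fun z => k p * h z + h p * k z)%C z).
  { intros z Hz; destruct (H2 _ Hz) as [[] _].
    apply continuous_Cplus; apply continuous_Cmult; try easy; apply continuous_Cconst. }
  rewrite (rect_ext _ (fun z => (h z - h p) * (k z - k p) + ((k p * h z + h p * k z) + (- (h p * k p))))%C)
    by (try easy; intros; ring).
  rewrite rect_plus; try easy; [|intros z [Hz _]; now apply c1|
    intros z [Hz _]; apply continuous_Cplus; [now apply c2|apply continuous_Cconst]].
  rewrite rect_plus; try easy; [|intros z [Hz _]; now apply c2|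
    intros z [Hz _]; apply continuous_Cconst].
  rewrite (rect_ext (fun _ => - _)%C (fun z => (- (h p * k p)) + (0 * RtoC (Re z) + 0 * RtoC (Im z)))%C)
    by (try easy; intros; ring).
  rewrite rect_affine by easy.
  match goal with |- Cmod ?x <= _ => replace x with
   (rect_int (fun z => (h z - h p) * (k z - k p))%C a b c d +
    (rect_int (fun z => k p * h z + h p * k z)%C a b c d -
     Ci * (k p * g + h p * (al + Ci * be)) * RtoC ((b - a) * (d - c))))%C by ring end.
  eapply Rle_trans; [apply Cmod_triangle|].
  assert (Hb : Cmod (rect_int (fun z => (h z - h p) * (k z - k p))%C a b c d)
     <= 2 * (eps / 4) * (b - a + (d - c)) ^ 2).
  { apply rect_bound_o with p; try easy; [lra|].
    intros z Hz; destruct (H2 _ Hz) as (_ & E1 & E2); rewrite Cmod_mult; fold M in E1.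
    replace (eps / 4 * Cmod (z - p)) with (eps / (4 * M) * (M * Cmod (z - p))) by (field; lra).
    apply Rmult_le_compat; try apply Cmod_ge_0; easy. }
  lra.
Qed.

Lemma has_dbar_unique h p g g' : has_dbar h p g -> has_dbar h p g' -> g = g'.
Proof.
intros [_ H] [_ K].
destruct (Req_dec (Cmod (g - g')) 0) as [E|E].
- apply Cmod_eq_0 in E; replace g with (g - g' + g')%C by ring; rewrite E; ring.
- exfalso; generalize (Cmod_ge_0 (g - g')); intros m0.
  set (e := Cmod (g - g') / 16); assert (e0 : 0 < e) by (unfold e; lra).
  destruct (H _ e0) as [d1 [d1p H1]]; destruct (K _ e0) as [d2 [d2p H2]].
  set (s := Rmin d1 d2 / 4).
  assert (s0 : 0 < Rmin d1 d2) by now apply Rmin_glb_lt.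
  generalize (Rmin_l d1 d2) (Rmin_r d1 d2); intros.
  assert (Hp : box (Re p) (Re p + s) (Im p) (Im p + s) p) by (unfold s; split; lra).
  specialize (H1 _ _ _ _ Hp ltac:(unfold s; lra)); specialize (H2 _ _ _ _ Hp ltac:(unfold s; lra)).
  replace (Re p + s - Re p) with s in * by ring; replace (Im p + s - Im p) with s in * by ring.
  set (I := rect_int _ _ _ _ _) in *.
  assert (X : Cmod (Ci * (g - g') * RtoC (s * s)) <= 2 * e * (s + s) ^ 2).
  { replace (Ci * (g - g') * RtoC (s * s))%C with
     ((I - Ci * g' * RtoC (s * s)) - (I - Ci * g * RtoC (s * s)))%C by ring.
    unfold Cminus at 1; eapply Rle_trans; [apply Cmod_triangle|]; rewrite Cmod_opp; lra. }
  rewrite !Cmod_mult, Cmod_Ci, Cmod_R, Rabs_pos_eq in X by (apply Rle_0_sqr).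
  assert (0 < s * s) by (apply Rmult_lt_0_compat; unfold s; lra).
  replace (2 * e * (s + s) ^ 2) with (Cmod (g - g') / 2 * (s * s)) in X by (unfold e; field).
  assert (0 < Cmod (g - g') * (s * s)) by (apply Rmult_lt_0_compat; lra).
  lra.
Qed.

(** * Goursat's bisection argument *)

Definition rect : Type := ((R * R) * (R * R))%type.

Section Bisection.
Variable P : R -> R -> R -> R -> Prop.
Hypothesis quarters : forall a b c d, a <= b -> c <= d ->
  P a ((a + b) / 2) c ((c + d) / 2) -> P ((a + b) / 2) b c ((c + d) / 2) ->
  P a ((a + b) / 2) ((c + d) / 2) d -> P ((a + b) / 2) b ((c + d) / 2) d ->
  P a b c d.

Let Pr (r : rect) := P (fst (fst r)) (snd (fst r)) (fst (snd r)) (snd (snd r)).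
Let size (r : rect) := (snd (fst r) - fst (fst r)) + (snd (snd r) - fst (snd r)).
Let inside (r s : rect) :=
  fst (fst s) <= fst (fst r) /\ fst (fst r) <= snd (fst r) /\ snd (fst r) <= snd (fst s) /\
  fst (snd s) <= fst (snd r) /\ fst (snd r) <= snd (snd r) /\ snd (snd r) <= snd (snd s).

Lemma bad_quarter (r : rect) : fst (fst r) <= snd (fst r) -> fst (snd r) <= snd (snd r) ->
  ~ Pr r -> exists s, inside s r /\ size s = size r / 2 /\ ~ Pr s.
Proof.
destruct r as [[a b] [c d]]; unfold Pr, size, inside; simpl; intros ab cd H.
destruct (classic (P a ((a + b) / 2) c ((c + d) / 2))) as [H1|H1];
  [|exists ((a, (a + b) / 2), (c, (c + d) / 2)); simpl; repeat split; try easy; lra].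
destruct (classic (P ((a + b) / 2) b c ((c + d) / 2))) as [H2|H2];
  [|exists (((a + b) / 2, b), (c, (c + d) / 2)); simpl; repeat split; try easy; lra].
destruct (classic (P a ((a + b) / 2) ((c + d) / 2) d)) as [H3|H3];
  [|exists ((a, (a + b) / 2), ((c + d) / 2, d)); simpl; repeat split; try easy; lra].
destruct (classic (P ((a + b) / 2) b ((c + d) / 2) d)) as [H4|H4];
  [|exists (((a + b) / 2, b), ((c + d) / 2, d)); simpl; repeat split; try easy; lra].
now destruct H; apply quarters.
Qed.

(** Otherwise one of the four quarters fails again; the failing rectangles are
    nested and shrink to a point, where the local hypothesis is violated. *)
Lemma bisection a b c d : a <= b -> c <= d ->
  (forall p, box a b c d p -> exists del, 0 < del /\
     forall a' b' c' d', a <= a' -> b' <= b -> c <= c' -> d' <= d ->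
       box a' b' c' d' p -> (b' - a') + (d' - c') < del -> P a' b' c' d') ->
  P a b c d.
Proof.
intros ab cd H.
destruct (classic (P a b c d)) as [|H0]; [easy|exfalso].
set (bad := fun r : rect => inside r ((a, b), (c, d)) /\ ~ Pr r).
assert (step : forall r, bad r -> exists s, bad s /\ inside s r /\ size s = size r / 2).
{ intros r [Hr Hb].
  destruct (bad_quarter r) as [s [Hs [Hz Hp]]]; try easy; [unfold inside in Hr; tauto..|].
  exists s; split; [|easy]; split; [|easy]; unfold inside in *; simpl in *; lra. }
set (next := fun r : {r | bad r} =>
  let (s, Hs) := constructive_indefinite_description _ (step (proj1_sig r) (proj2_sig r)) in
  exist bad s (proj1 Hs)).
assert (r0 : bad ((a, b), (c, d))) by (split; [unfold inside; simpl; lra|easy]).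
set (u := fun n => Nat.iter n next (exist bad _ r0)).
assert (uS : forall n, inside (proj1_sig (u (S n))) (proj1_sig (u n)) /\
   size (proj1_sig (u (S n))) = size (proj1_sig (u n)) / 2).
{ intros n; change (u (S n)) with (next (u n)); unfold next; destruct (constructive_indefinite_description _ _) as [s Hs]; simpl; tauto. }
assert (uI : forall n m, inside (proj1_sig (u (m + n)%nat)) (proj1_sig (u n))).
{ intros n m; induction m as [|m IH].
  - destruct (proj2_sig (u n)) as [K _]; revert K; unfold inside; simpl; lra.
  - destruct (uS (m + n)%nat) as [K _]; revert K IH; simpl; unfold inside; lra. }
assert (uD : forall n m, exists k, inside (proj1_sig (u k)) (proj1_sig (u n)) /\
    inside (proj1_sig (u k)) (proj1_sig (u m))).
{ intros n m; exists (m + n)%nat; split; [apply uI|].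
  rewrite Nat.add_comm; apply uI. }
assert (lubx : exists x, forall n, fst (fst (proj1_sig (u n))) <= x <= snd (fst (proj1_sig (u n)))).
{ destruct (completeness (fun x => exists n, x = fst (fst (proj1_sig (u n))))) as [x [Hx Hl]].
  - exists b; intros x [n ->]; destruct (proj2_sig (u n)) as [K _]; unfold inside in K; simpl in K; lra.
  - exists a, O; easy.
  - exists x; intros n; split; [apply Hx; now exists n|].
    apply Hl; intros y [m ->]; destruct (uD n m) as [k []]; unfold inside in *; lra. }
assert (luby : exists y, forall n, fst (snd (proj1_sig (u n))) <= y <= snd (snd (proj1_sig (u n)))).
{ destruct (completeness (fun x => exists n, x = fst (snd (proj1_sig (u n))))) as [x [Hx Hl]].
  - exists d; intros x [n ->]; destruct (proj2_sig (u n)) as [K _]; unfold inside in K; simpl in K; lra.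
  - exists c, O; easy.
  - exists x; intros n; split; [apply Hx; now exists n|].
    apply Hl; intros y [m ->]; destruct (uD n m) as [k []]; unfold inside in *; lra. }
destruct lubx as [x Hx], luby as [y Hy].
destruct (H (x, y)) as [del [d0 Hd]].
{ generalize (Hx O) (Hy O); unfold box; simpl; lra. }
assert (sz : forall n, size (proj1_sig (u n)) = size ((a, b), (c, d)) * (1 / 2) ^ n).
{ induction n as [|n IH]; [simpl; ring|].
  rewrite (proj2 (uS n)), IH; simpl; field. }
destruct (pow_lt_1_zero (1 / 2)) with (y := del / (size ((a, b), (c, d)) + 1)) as [N HN].
- rewrite Rabs_pos_eq; lra.
- apply Rdiv_lt_0_compat; unfold size; simpl; lra.
- specialize (HN N (le_n N)); rewrite Rabs_pos_eq in HN by (apply pow_le; lra).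
  destruct (proj2_sig (u N)) as [K1 K2].
  generalize (sz N) (Hx N) (Hy N); intros E Ex Ey.
  destruct (proj1_sig (u N)) as [[a' b'] [c' d']]; apply K2; unfold Pr, inside, size in *; simpl in *.
  apply Hd; try lra; [split; simpl; lra|].
  rewrite E; set (s := b - a + (d - c)) in *.
  assert (0 <= s) by (unfold s; lra).
  apply Rlt_div_r in HN; [|lra].
  assert (0 <= (1 / 2) ^ N) by (apply pow_le; lra).
  lra.
Qed.
End Bisection.

(** A pointwise bound on areolar derivatives integrates to a bound on contour
    integrals.  Using as majorant the areolar derivative [mu] of an explicit
    function [m] replaces the area integral of [mu] by a contour integral, so no
    double integral, in particular no improper one, ever occurs. *)
Lemma dbar_dominated (h m g : C -> C) (mu : C -> R) a b c d : a <= b -> c <= d ->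
  (forall z, box a b c d z -> has_dbar h z (g z)) ->
  (forall z, box a b c d z -> has_dbar m z (RtoC (mu z))) ->
  (forall z, box a b c d z -> Cmod (g z) <= mu z) ->
  Cmod (rect_int h a b c d) <= Im (rect_int m a b c d).
Proof.
intros ab cd Hh Hm Hg; apply Rle_plus_epsilon; intros e e0.
set (eps := e / (((b - a) + (d - c)) ^ 2 + 1)).
assert (s0 : 0 <= ((b - a) + (d - c)) ^ 2) by (apply pow_le; lra).
assert (eps0 : 0 < eps) by (apply Rdiv_lt_0_compat; lra).
apply Rle_trans with (Im (rect_int m a b c d) + eps * ((b - a) + (d - c)) ^ 2).
2: { apply Rplus_le_compat_l. unfold eps. apply Rle_trans with (e / (((b - a) + (d - c)) ^ 2 + 1) * (((b - a) + (d - c)) ^ 2 + 1)); [|right; field; lra].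
  apply Rmult_le_compat_l; [apply Rlt_le, eps0|lra]. }
apply (bisection (fun a' b' c' d' => a <= a' -> b' <= b -> c <= c' -> d' <= d ->
   Cmod (rect_int h a' b' c' d') <= Im (rect_int m a' b' c' d') + eps * ((b' - a') + (d' - c')) ^ 2));
  try easy; try lra.
- intros a' b' c' d' ab' cd' H1 H2 H3 H4 la lb lc ld.
  assert (F : forall k, (forall z, box a b c d z -> continuous k z) ->
    rect_int k a' b' c' d' =
     (rect_int k a' ((a' + b') / 2) c' ((c' + d') / 2) + rect_int k ((a' + b') / 2) b' c' ((c' + d') / 2) +
     (rect_int k a' ((a' + b') / 2) ((c' + d') / 2) d' + rect_int k ((a' + b') / 2) b' ((c' + d') / 2) d'))%C).
  { intros k Hk.
    rewrite (rect_split_h _ _ _ _ _ ((c' + d') / 2)); [|lra|lra|intros z [[] _]; apply Hk; split; lra].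
    f_equal; apply rect_split_v; try lra; intros z [[] _]; apply Hk; split; lra. }
  rewrite (F h), (F m) by (intros z Hz; eapply has_dbar_continuous; eauto).
  specialize (H1 ltac:(lra) ltac:(lra) ltac:(lra) ltac:(lra)).
  specialize (H2 ltac:(lra) ltac:(lra) ltac:(lra) ltac:(lra)).
  specialize (H3 ltac:(lra) ltac:(lra) ltac:(lra) ltac:(lra)).
  specialize (H4 ltac:(lra) ltac:(lra) ltac:(lra) ltac:(lra)).
  eapply Rle_trans; [apply Cmod_triangle|].
  eapply Rle_trans; [apply Rplus_le_compat; apply Cmod_triangle|].
  unfold Im in *; simpl snd in *.
  eapply Rle_trans;
    [exact (Rplus_le_compat _ _ _ _ (Rplus_le_compat _ _ _ _ H1 H2) (Rplus_le_compat _ _ _ _ H3 H4))|].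
  right; simpl; field.
- intros p Hp.
  assert (e2 : 0 < eps / 2) by lra.
  destruct (proj2 (Hh p Hp) _ e2) as [d1 [d1p H1]], (proj2 (Hm p Hp) _ e2) as [d2 [d2p H2]].
  exists (Rmin d1 d2); split; [now apply Rmin_glb_lt|].
  intros a' b' c' d' _ _ _ _ Hb Hs _ _ _ _.
  generalize (Rmin_l d1 d2) (Rmin_r d1 d2); intros.
  specialize (H1 _ _ _ _ Hb ltac:(lra)); specialize (H2 _ _ _ _ Hb ltac:(lra)).
  destruct (box_order _ _ _ _ _ Hb).
  set (A := (b' - a') * (d' - c')) in *; assert (0 <= A) by (apply Rmult_le_pos; lra).
  generalize (Cmod_sub_ge (rect_int h a' b' c' d') (Ci * g p * RtoC A)); intros K1.
  rewrite !Cmod_mult, Cmod_Ci, Cmod_R, Rabs_pos_eq in K1 by easy.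
  generalize (Rmult_le_compat_r A _ _ ltac:(easy) (Hg p Hp)); intros K2.
  generalize (im_le_Cmod (rect_int m a' b' c' d' - Ci * RtoC (mu p) * RtoC A)); intros K3.
  replace (Im _) with (Im (rect_int m a' b' c' d') - mu p * A) in K3 by (unfold Im; simpl; ring).
  apply Rabs_le_between in K3; lra.
Qed.

Ltac sqpos s0 t :=
  generalize (Rle_0_sqr t) (Rmult_lt_0_compat _ _ s0 s0); unfold Rsqr; intros; lra.
Ltac sqnz s0 t := apply Rgt_not_eq; sqpos s0 t.

(** * The Cauchy kernel *)
Lemma pole_edge_continuous q s x : 0 < s ->
  continuous (T := R_UniformSpace) (U := C_R_NormedModule)
   (fun x => (((x - q) / (s ^ 2 + (x - q) ^ 2), s / (s ^ 2 + (x - q) ^ 2)) : C)) x.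
Proof.
intros s0; apply (continuous_comp_2 (fun x => (x - q) / (s ^ 2 + (x - q) ^ 2))
  (fun x => s / (s ^ 2 + (x - q) ^ 2)) (fun u v => (u, v) : C)).
- apply (ex_derive_continuous (V := R_NormedModule)); auto_derive; sqnz s0 (x - q).
- apply (ex_derive_continuous (V := R_NormedModule)); auto_derive; sqnz s0 (x - q).
- apply continuous_ext with (fun z : R * R => z); [intros []; easy|apply continuous_id].
Qed.

Lemma pole_edge q s : 0 < s ->
  CInt (fun x => (((x - q) / (s ^ 2 + (x - q) ^ 2), s / (s ^ 2 + (x - q) ^ 2)) : C)) (q - s) (q + s)
    = (Ci * RtoC (PI / 2))%C.
Proof.
intros s0; rewrite (CInt_derive (fun x => ((ln (s ^ 2 + (x - q) ^ 2) / 2, atan ((x - q) / s)) : C))).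
- replace (q + s - q) with s by ring; replace (q - s - q) with (- s) by ring.
  replace ((- s) ^ 2) with (s ^ 2) by ring.
  replace (s / s) with 1 by (field; lra); replace (- s / s) with (- (1)) by (field; lra).
  rewrite atan_opp, atan_1; apply injective_projections; simpl; field.
- lra.
- intros x _; simpl; auto_derive; [sqpos s0 (x - q)|field; sqnz s0 (x - q)].
- intros x _; simpl; auto_derive; [easy|unfold Rsqr; field; split; [|lra]; sqnz s0 (x - q)].
- intros x _; now apply pole_edge_continuous.
Qed.

(** Each edge contributes [Ci * PI / 2]: up to conjugation and a factor, the
    integrand is the same function on the four edges. *)
Lemma rect_pole (p : C) s : 0 < s ->
  rect_int (fun z => / (z - p))%C (Re p - s) (Re p + s) (Im p - s) (Im p + s)
    = (Ci * RtoC (2 * PI))%C.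
Proof.
intros s0.
set (e := fun q x => ((x - q) / (s ^ 2 + (x - q) ^ 2), s / (s ^ 2 + (x - q) ^ 2)) : C).
assert (ex : forall q, ex_RInt (V := C_R_NormedModule) (e q) (q - s) (q + s)).
{ intros q; apply (@ex_RInt_continuous C_R_CompleteNormedModule); intros x _.
  now apply pole_edge_continuous. }
unfold rect_int.
rewrite (CInt_ext (fun x => / ((x, (Im p - s)%R) - p))%C (e (Re p))).
2: lra.
2: { intros x _; unfold e; apply injective_projections; simpl;
     change (fst p) with (Re p); change (snd p) with (Im p);
     field; try split; sqnz s0 (x - Re p). }
rewrite (CInt_ext (fun x => / ((x, (Im p + s)%R) - p))%C (fun x => Cconj (e (Re p) x))).
2: lra.
2: { intros x _; unfold e; apply injective_projections; simpl;
     change (fst p) with (Re p); change (snd p) with (Im p);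
     field; try split; sqnz s0 (x - Re p). }
rewrite (CInt_ext (fun y => / (((Re p + s)%R, y) - p))%C (fun y => - Ci * e (Im p) y)%C).
2: lra.
2: { intros y _; unfold e; apply injective_projections; simpl;
     change (fst p) with (Re p); change (snd p) with (Im p);
     field; try split; sqnz s0 (y - Im p). }
rewrite (CInt_ext (fun y => / (((Re p - s)%R, y) - p))%C (fun y => - Ci * Cconj (e (Im p) y))%C).
2: lra.
2: { intros y _; unfold e; apply injective_projections; simpl;
     change (fst p) with (Re p); change (snd p) with (Im p);
     field; try split; sqnz s0 (y - Im p). }
assert (exc : ex_RInt (V := C_R_NormedModule) (fun y => Cconj (e (Im p) y)) (Im p - s) (Im p + s)).
{ destruct (ex (Im p)) as [I HI]; exists (Cconj I).
  apply (is_RInt_fct_extend_pair (U := R_NormedModule) (V := R_NormedModule)).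
  - apply (is_RInt_fct_extend_fst _ _ _ _ HI).
  - apply (is_RInt_opp (V := R_NormedModule)), (is_RInt_fct_extend_snd _ _ _ _ HI). }
rewrite (CInt_conj _ _ _ (ex (Re p))), (CInt_Cmult_l _ _ _ _ (ex (Im p))), (CInt_Cmult_l _ _ _ _ exc),
  (CInt_conj _ _ _ (ex (Im p))).
unfold e; rewrite !pole_edge by easy.
apply injective_projections; simpl; field.
Qed.

Lemma locally_square p P : locally p P -> exists s0, 0 < s0 /\ forall s, 0 < s <= s0 ->
  forall z, box (Re p - s) (Re p + s) (Im p - s) (Im p + s) z -> P z.
Proof.
intros H; destruct (locally_box _ _ H) as [del [d0 Hd]].
exists (del / 5); split; [lra|]; intros s Hs z Hz.
apply (Hd (Re p - s) (Re p + s) (Im p - s) (Im p + s)); [split; lra|lra|easy].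
Qed.

Lemma frame_pole_dist p s z : 0 < s ->
  frame (Re p - s) (Re p + s) (Im p - s) (Im p + s) z -> s <= Cmod (z - p).
Proof.
intros s0 [_ H].
assert (s <= Rabs (Re (z - p)) \/ s <= Rabs (Im (z - p))) as [K|K].
{ rewrite Re_minus, Im_minus; unfold Rabs; destruct (Rcase_abs (Re z - Re p)), (Rcase_abs (Im z - Im p));
  intuition lra. }
- eapply Rle_trans; [exact K|apply re_le_Cmod].
- eapply Rle_trans; [exact K|apply im_le_Cmod].
Qed.

(** On the square of half side [s] the difference between [H] and [A / (z - p)]
    is [o(1 / s)], and the perimeter is [8 * s]. *)
Lemma residue_limit (H : C -> C) (p A : C) :
  locally p (fun z => z <> p -> continuous H z) ->
  (forall eps, 0 < eps -> locally p (fun z => z <> p -> Cmod ((z - p) * H z - A) <= eps)) ->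
  forall eps, 0 < eps -> exists s0, 0 < s0 /\ forall s, 0 < s <= s0 ->
   Cmod (rect_int H (Re p - s) (Re p + s) (Im p - s) (Im p + s) - A * (Ci * RtoC (2 * PI))) <= eps.
Proof.
intros Hc HA eps e0.
assert (e1 : 0 < eps / 8) by lra.
destruct (locally_square _ _ (filter_and _ _ Hc (HA _ e1))) as [s0 [s0p Hs]].
exists s0; split; [easy|]; intros s Hs0.
specialize (Hs s Hs0).
assert (off : forall z, frame (Re p - s) (Re p + s) (Im p - s) (Im p + s) z -> z <> p).
{ intros z Hz E; generalize (frame_pole_dist p s z ltac:(lra) Hz).
  rewrite E; replace (p - p)%C with (RtoC 0) by ring; rewrite Cmod_0; lra. }
assert (cK : cont_frame (fun z => / (z - p))%C (Re p - s) (Re p + s) (Im p - s) (Im p + s)).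
{ intros z Hz; apply continuous_Cinv; [|now apply Csub_neq, off].
  apply continuous_Cminus; [apply continuous_id|apply continuous_Cconst]. }
assert (cH : cont_frame H (Re p - s) (Re p + s) (Im p - s) (Im p + s)).
{ intros z Hz; apply Hs; [apply Hz|now apply off]. }
assert (cAK : cont_frame (fun z => A * / (z - p))%C (Re p - s) (Re p + s) (Im p - s) (Im p + s)).
{ intros z Hz; apply continuous_Cmult; [apply continuous_Cconst|now apply cK]. }
rewrite <- (rect_pole p s) by lra.
rewrite <- rect_scal, <- rect_minus by (easy || lra).
apply Rle_trans with (2 * (eps / 8 / s) * ((Re p + s - (Re p - s)) + (Im p + s - (Im p - s)))).
2: right; field; lra.
apply rect_bound; try lra.
- intros z Hz; apply continuous_Cminus; [now apply cH|now apply cAK].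
- intros z Hz; generalize (frame_pole_dist p s z ltac:(lra) Hz); intros D.
  generalize (Csub_neq _ _ (off _ Hz)); intros nz.
  replace (H z - A * / (z - p))%C with (((z - p) * H z - A) / (z - p))%C by (field; easy).
  rewrite Cmod_div by easy.
  apply Rmult_le_compat; [apply Cmod_ge_0|apply Rlt_le, Rinv_0_lt_compat; lra| |apply Rinv_le_contravar; lra].
  apply Hs; [apply Hz|now apply off].
Qed.

(** A small square around [p] carries the residue.  The rest of the rectangle is
    cut into four rectangles free of the pole, to which the domination principle
    applies; the integrals of [m] add up to the outer one minus that over the
    small square, both controlled by the bound [K] on [m]. *)
Lemma dbar_pole (H m g : C -> C) (mu : C -> R) (p A : C) K a b c d :
  a < Re p < b -> c < Im p < d ->
  (forall z, box a b c d z -> z <> p -> has_dbar H z (g z)) ->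
  (forall z, box a b c d z -> z <> p -> has_dbar m z (RtoC (mu z))) ->
  (forall z, box a b c d z -> z <> p -> Cmod (g z) <= mu z) ->
  (forall z, Cmod (m z) <= K) ->
  (forall eps, 0 < eps -> locally p (fun z => z <> p -> Cmod ((z - p) * H z - A) <= eps)) ->
  Cmod (rect_int H a b c d - A * (Ci * RtoC (2 * PI))) <= 2 * K * ((b - a) + (d - c)).
Proof.
intros pa pc Hh Hm Hg HK HA.
apply Rle_plus_epsilon; intros eps e0; assert (e1 : 0 < eps / 2) by lra.
assert (K0 : 0 <= K) by (eapply Rle_trans; [apply (Cmod_ge_0 (m p))|apply HK]).
assert (Lp : locally p (box a b c d)).
{ set (r := Rmin (Rmin (Re p - a) (b - Re p)) (Rmin (Im p - c) (d - Im p))).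
  assert (0 < r) by (unfold r; repeat apply Rmin_glb_lt; lra).
  apply locally_Cmod; exists r; split; [easy|]; intros z Hz.
  generalize (re_le_Cmod (z - p)) (im_le_Cmod (z - p)); rewrite Re_minus, Im_minus; intros X Y.
  assert (X1 := Rle_trans _ _ _ X (Rlt_le _ _ Hz)); assert (Y1 := Rle_trans _ _ _ Y (Rlt_le _ _ Hz)).
  apply Rabs_le_between in X1; apply Rabs_le_between in Y1.
  generalize (Rmin_l (Rmin (Re p - a) (b - Re p)) (Rmin (Im p - c) (d - Im p)))
   (Rmin_r (Rmin (Re p - a) (b - Re p)) (Rmin (Im p - c) (d - Im p)))
   (Rmin_l (Re p - a) (b - Re p)) (Rmin_r (Re p - a) (b - Re p))
   (Rmin_l (Im p - c) (d - Im p)) (Rmin_r (Im p - c) (d - Im p)); fold r; intros.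
  split; lra. }
destruct (residue_limit H p A) with (eps := eps / 2) as [s1 [s1p Hs1]]; try easy.
{ revert Lp; apply filter_imp; intros z Hz nz; eapply has_dbar_continuous, Hh; easy. }
set (s := Rmin (Rmin s1 (eps / 2 / (8 * K + 1))) (Rmin (Rmin (Re p - a) (b - Re p)) (Rmin (Im p - c) (d - Im p)) / 2)).
assert (e2 : 0 < eps / 2 / (8 * K + 1)) by (apply Rdiv_lt_0_compat; lra).
set (r := Rmin (Rmin (Re p - a) (b - Re p)) (Rmin (Im p - c) (d - Im p))) in s.
assert (r0 : 0 < r) by (unfold r; repeat apply Rmin_glb_lt; lra).
assert (s0 : 0 < s) by (unfold s; repeat apply Rmin_glb_lt; lra).
assert (sb : s <= s1 /\ s <= eps / 2 / (8 * K + 1) /\ s < Re p - a /\ s < b - Re p /\ s < Im p - c /\ s < d - Im p).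
{ generalize (Rmin_l (Rmin (Re p - a) (b - Re p)) (Rmin (Im p - c) (d - Im p)))
   (Rmin_r (Rmin (Re p - a) (b - Re p)) (Rmin (Im p - c) (d - Im p)))
   (Rmin_l (Re p - a) (b - Re p)) (Rmin_r (Re p - a) (b - Re p))
   (Rmin_l (Im p - c) (d - Im p)) (Rmin_r (Im p - c) (d - Im p)); fold r; intros.
  generalize (Rmin_l (Rmin s1 (eps / 2 / (8 * K + 1))) (r / 2)) (Rmin_r (Rmin s1 (eps / 2 / (8 * K + 1))) (r / 2))
   (Rmin_l s1 (eps / 2 / (8 * K + 1))) (Rmin_r s1 (eps / 2 / (8 * K + 1))); fold s; intros; lra. }
destruct sb as (sb1 & sb2 & sb3 & sb4 & sb5 & sb6).
specialize (Hs1 s (conj s0 sb1)).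
set (p1 := Re p - s) in *; set (p2 := Re p + s) in *; set (q1 := Im p - s) in *; set (q2 := Im p + s) in *.
(* The central square, the strips left and right of it over the full height,
   and the two pieces above and below it. *)
assert (F : forall k, (forall z, box a b c d z -> z <> p -> continuous k z) ->
  rect_int k a b c d = (rect_int k a p1 c d + (rect_int k p1 p2 c q1 +
    (rect_int k p1 p2 q1 q2 + rect_int k p1 p2 q2 d) + rect_int k p2 b c d))%C).
{ intros k Hk.
  assert (Hc : forall a' b' c' d', a <= a' -> b' <= b -> c <= c' -> d' <= d ->
     (forall z, frame a' b' c' d' z -> z <> p) -> cont_frame k a' b' c' d').
  { intros a' b' c' d' ? ? ? ? np z Hz; apply Hk; [|now apply np].
    destruct Hz as [[] _]; split; lra. }
  rewrite (rect_split_v k a b c d p1); [|unfold p1; lra|lra|].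
  2: { apply Hc; try lra; intros z [_ Hz] ->; lra. }
  rewrite (rect_split_v k p1 b c d p2); [|unfold p1, p2; lra|lra|].
  2: { apply Hc; try (unfold p1; lra); intros z [_ Hz] ->; unfold p1 in Hz; lra. }
  rewrite (rect_split_h k p1 p2 c d q1); [|unfold q1; lra|unfold p1, p2; lra|].
  2: { apply Hc; try (unfold p1, p2; lra); intros z [_ Hz] ->; unfold p1, p2 in Hz; lra. }
  rewrite (rect_split_h k p1 p2 q1 d q2); [|unfold q1, q2; lra|unfold p1, p2; lra|].
  2: { apply Hc; try (unfold p1, p2, q1; lra); intros z [_ Hz] ->; unfold p1, p2, q1 in Hz; lra. }
  ring. }
assert (D : forall a' b' c' d', a <= a' -> a' <= b' -> b' <= b -> c <= c' -> c' <= d' -> d' <= d ->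
  (forall z, box a' b' c' d' z -> z <> p) ->
  Cmod (rect_int H a' b' c' d') <= Im (rect_int m a' b' c' d')).
{ intros a' b' c' d' ? ? ? ? ? ? np; apply dbar_dominated with g mu; try easy;
  intros z Hz; (assert (Hz' : box a b c d z) by (destruct Hz; split; lra)); auto. }
assert (D1 : Cmod (rect_int H a p1 c d) <= Im (rect_int m a p1 c d)).
{ apply D; try (unfold p1, p2, q1, q2; lra); intros z [Hz _] ->; unfold p1 in Hz; lra. }
assert (D2 : Cmod (rect_int H p2 b c d) <= Im (rect_int m p2 b c d)).
{ apply D; try (unfold p1, p2, q1, q2; lra); intros z [Hz _] ->; unfold p2 in Hz; lra. }
assert (D3 : Cmod (rect_int H p1 p2 c q1) <= Im (rect_int m p1 p2 c q1)).
{ apply D; try (unfold p1, p2, q1, q2; lra); intros z [_ Hz] ->; unfold q1 in Hz; lra. }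
assert (D4 : Cmod (rect_int H p1 p2 q2 d) <= Im (rect_int m p1 p2 q2 d)).
{ apply D; try (unfold p1, p2, q1, q2; lra); intros z [_ Hz] ->; unfold q2 in Hz; lra. }
assert (B1 : Im (rect_int m a b c d) <= 2 * K * ((b - a) + (d - c))).
{ eapply Rle_trans; [apply Rle_abs|]; eapply Rle_trans; [apply im_le_Cmod|].
  apply rect_bound; try lra; [|intros; apply HK].
  intros z [Hz Fz]; eapply has_dbar_continuous, Hm; [easy|]; intros ->; lra. }
assert (B2 : - Im (rect_int m p1 p2 q1 q2) <= eps / 2).
{ apply Rle_trans with (2 * K * ((p2 - p1) + (q2 - q1))).
  - apply Rle_trans with (Rabs (Im (rect_int m p1 p2 q1 q2))); [rewrite <- Rabs_Ropp; apply Rle_abs|].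
    eapply Rle_trans; [apply im_le_Cmod|].
    apply rect_bound; try (unfold p1, p2, q1, q2; lra); [|intros; apply HK].
    intros z [Hz Fz]; eapply has_dbar_continuous, Hm.
    + destruct Hz; split; unfold p1, p2, q1, q2 in *; lra.
    + intros ->; unfold p1, p2, q1, q2 in *; lra.
  - unfold p1, p2, q1, q2. apply Rle_div_r in sb2; lra. }
rewrite F by (intros z Hz nz; eapply has_dbar_continuous, Hh; easy).
rewrite (F m) in B1 by (intros z Hz nz; eapply has_dbar_continuous, Hm; easy).
change (Im (rect_int m a p1 c d) + (Im (rect_int m p1 p2 c q1) +
    (Im (rect_int m p1 p2 q1 q2) + Im (rect_int m p1 p2 q2 d)) + Im (rect_int m p2 b c d))
  <= 2 * K * (b - a + (d - c))) in B1.
match goal with |- Cmod ?x <= _ => replace x with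
  (rect_int H a p1 c d + (rect_int H p1 p2 c q1 + (rect_int H p1 p2 q2 d + (rect_int H p2 b c d +
   (rect_int H p1 p2 q1 q2 - A * (Ci * RtoC (2 * PI)))))))%C by ring end.
eapply Rle_trans; [apply Cmod_triangle|]; eapply Rle_trans; [apply Rplus_le_compat_l, Cmod_triangle|].
eapply Rle_trans; [apply Rplus_le_compat_l, Rplus_le_compat_l, Cmod_triangle|].
eapply Rle_trans; [apply Rplus_le_compat_l, Rplus_le_compat_l, Rplus_le_compat_l, Cmod_triangle|].
lra.
Qed.

(** * Difference quotients through a kernel with two poles *)

(** The poles are separated by a line halfway between them, vertical or
    horizontal; the integral of [m] along it costs a factor 2. *)
Lemma dbar_two_poles (H m g : C -> C) (mu : C -> R) (p1 p2 A1 A2 : C) K a b c d :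
  a < Re p1 < b -> c < Im p1 < d -> a < Re p2 < b -> c < Im p2 < d ->
  Re p1 < Re p2 \/ Im p1 < Im p2 ->
  (forall z, box a b c d z -> z <> p1 -> z <> p2 -> has_dbar H z (g z)) ->
  (forall z, box a b c d z -> z <> p1 -> z <> p2 -> has_dbar m z (RtoC (mu z))) ->
  (forall z, box a b c d z -> z <> p1 -> z <> p2 -> Cmod (g z) <= mu z) ->
  (forall z, Cmod (m z) <= K) ->
  (forall eps, 0 < eps -> locally p1 (fun z => z <> p1 -> Cmod ((z - p1) * H z - A1) <= eps)) ->
  (forall eps, 0 < eps -> locally p2 (fun z => z <> p2 -> Cmod ((z - p2) * H z - A2) <= eps)) ->
  Cmod (rect_int H a b c d - (A1 + A2) * (Ci * RtoC (2 * PI))) <= 4 * K * ((b - a) + (d - c)).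
Proof.
intros a1 c1 a2 c2 Hlt Hh Hm Hg HK HA1 HA2.
assert (K0 : 0 <= K) by (eapply Rle_trans; [apply (Cmod_ge_0 (m p1))|apply HK]).
assert (P1 : forall a' b' c' d', a <= a' -> b' <= b -> c <= c' -> d' <= d -> ~ box a' b' c' d' p2 ->
  a' < Re p1 < b' -> c' < Im p1 < d' ->
  Cmod (rect_int H a' b' c' d' - A1 * (Ci * RtoC (2 * PI))) <= 2 * K * ((b' - a') + (d' - c'))).
{ intros a' b' c' d' ? ? ? ? np ? ?; apply (dbar_pole H m g mu p1); try easy; intros z Hz n1;
  (assert (Hz' : box a b c d z) by (destruct Hz; split; lra));
  (assert (n2 : z <> p2) by (intros ->; easy)); auto. }
assert (P2 : forall a' b' c' d', a <= a' -> b' <= b -> c <= c' -> d' <= d -> ~ box a' b' c' d' p1 ->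
  a' < Re p2 < b' -> c' < Im p2 < d' ->
  Cmod (rect_int H a' b' c' d' - A2 * (Ci * RtoC (2 * PI))) <= 2 * K * ((b' - a') + (d' - c'))).
{ intros a' b' c' d' ? ? ? ? np ? ?; apply (dbar_pole H m g mu p2); try easy; intros z Hz n2;
  (assert (Hz' : box a b c d z) by (destruct Hz; split; lra));
  (assert (n1 : z <> p1) by (intros ->; easy)); auto. }
assert (cH : cont_frame H a b c d).
{ intros z [Hz Fz]; eapply has_dbar_continuous, Hh; [easy|intros ->; lra|intros ->; lra]. }
destruct Hlt as [Hlt|Hlt].
- set (x := (Re p1 + Re p2) / 2).
  assert (D1 := P1 a x c d ltac:(lra) ltac:(unfold x; lra) ltac:(lra) ltac:(lra)
    ltac:(intros [? _]; unfold x in *; lra) ltac:(unfold x; lra) c1).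
  assert (D2 := P2 x b c d ltac:(unfold x; lra) ltac:(lra) ltac:(lra) ltac:(lra)
    ltac:(intros [? _]; unfold x in *; lra) ltac:(unfold x; lra) c2).
  rewrite (rect_split_v H a b c d x) by (easy || unfold x; lra).
  match goal with |- Cmod ?e <= _ => replace e with
    ((rect_int H a x c d - A1 * (Ci * RtoC (2 * PI))) + (rect_int H x b c d - A2 * (Ci * RtoC (2 * PI))))%C
    by ring end.
  eapply Rle_trans; [apply Cmod_triangle|].
  assert (0 <= K * (d - c)) by (apply Rmult_le_pos; lra).
  assert (0 <= K * (b - a)) by (apply Rmult_le_pos; lra).
  lra.
- set (x := (Im p1 + Im p2) / 2).
  assert (D1 := P1 a b c x ltac:(lra) ltac:(lra) ltac:(lra) ltac:(unfold x; lra)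
    ltac:(intros [_ ?]; unfold x in *; lra) a1 ltac:(unfold x; lra)).
  assert (D2 := P2 a b x d ltac:(lra) ltac:(lra) ltac:(unfold x; lra) ltac:(lra)
    ltac:(intros [_ ?]; unfold x in *; lra) a2 ltac:(unfold x; lra)).
  rewrite (rect_split_h H a b c d x) by (easy || unfold x; lra).
  match goal with |- Cmod ?e <= _ => replace e with
    ((rect_int H a b c x - A1 * (Ci * RtoC (2 * PI))) + (rect_int H a b x d - A2 * (Ci * RtoC (2 * PI))))%C
    by ring end.
  eapply Rle_trans; [apply Cmod_triangle|].
  assert (0 <= K * (d - c)) by (apply Rmult_le_pos; lra).
  assert (0 <= K * (b - a)) by (apply Rmult_le_pos; lra).
  lra.
Qed.

Lemma Cdiff_comp_R (h : C -> R) (g : R -> R) (q al be : C) (l : R) :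
  Cdiff (fun z => RtoC (h z)) q al be -> is_derive g (h q) l ->
  Cdiff (fun z => RtoC (g (h z))) q (RtoC l * al) (RtoC l * be).
Proof.
intros H G eps e0.
set (M := Cmod al + Cmod be + 1).
generalize (Cmod_ge_0 al) (Cmod_ge_0 be); intros.
assert (M0 : 0 < M) by (unfold M; lra).
assert (e1 : 0 < eps / (2 * M)) by (apply Rdiv_lt_0_compat; lra).
assert (e2 : 0 < eps / (2 * (Rabs l + 1))) by (apply Rdiv_lt_0_compat; generalize (Rabs_pos l); lra).
apply is_derive_Reals in G; destruct (G _ e1) as [del Hdel].
generalize (filter_and _ _ (H _ e2) (filter_and _ _ (Cdiff_lipschitz _ _ _ _ H)
  (proj1 (continuous_Cmod _ _) (Cdiff_continuous _ _ _ _ H) (del / 2) ltac:(destruct del; simpl; lra)))).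
apply filter_imp; intros z (E1 & E2 & E3); fold M in E2.
set (L := (al * RtoC (Re z - Re q) + be * RtoC (Im z - Im q))%C) in *.
rewrite <- RtoC_minus, Cmod_R in E2, E3.
assert (E4 : Rabs (g (h z) - g (h q) - l * (h z - h q)) <= eps / (2 * M) * Rabs (h z - h q)).
{ destruct (Req_dec (h z - h q) 0) as [E|E].
  - replace (h z) with (h q) by lra; replace (g (h q) - g (h q) - l * (h q - h q)) with 0 by ring.
    rewrite Rabs_R0; apply Rmult_le_pos; [lra|apply Rabs_pos].
  - assert (E5 := Hdel _ E ltac:(destruct del; simpl in *; lra)).
    replace (h q + (h z - h q)) with (h z) in E5 by ring.
    replace (g (h z) - g (h q) - l * (h z - h q)) with
      (((g (h z) - g (h q)) / (h z - h q) - l) * (h z - h q)) by (field; easy).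
    rewrite Rabs_mult; apply Rmult_le_compat_r; [apply Rabs_pos|lra]. }
match goal with |- Cmod ?x <= _ => replace x with
  (RtoC (g (h z) - g (h q) - l * (h z - h q)) + RtoC l * (RtoC (h z) - RtoC (h q) - L))%C
  by (unfold L; rewrite !RtoC_minus, RtoC_mult, !RtoC_minus; ring) end.
eapply Rle_trans; [apply Cmod_triangle|]; rewrite Cmod_mult, !Cmod_R.
set (r := Cmod (z - q)) in *; assert (0 <= r) by apply Cmod_ge_0.
generalize (Rabs_pos l); intros.
apply Rle_trans with (eps / (2 * M) * (M * r) + (Rabs l + 1) * (eps / (2 * (Rabs l + 1)) * r)).
2: right; field; lra.
apply Rplus_le_compat.
- apply (Rle_trans _ _ _ E4); apply Rmult_le_compat_l; lra.
- apply Rmult_le_compat; [lra|apply Cmod_ge_0|lra|exact E1].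
Qed.

Lemma Cdiff_sub (p q : C) : Cdiff (fun z => z - p)%C q 1 Ci.
Proof.
eapply Cdiff_eq; [apply (Cdiff_plus _ (fun _ => - p)%C); [apply Cdiff_id|apply Cdiff_const]|ring|ring].
Qed.

Lemma Cdiff_Cmod (p q : C) : q <> p ->
  Cdiff (fun z => RtoC (Cmod (z - p))) q (RtoC (Re (q - p) / Cmod (q - p))) (RtoC (Im (q - p) / Cmod (q - p))).
Proof.
intros nq; generalize (proj1 (Cmod_gt_0 _) (Csub_neq _ _ nq)); intros D.
apply Cdiff_ext with (fun z => RtoC (sqrt (Cmod (z - p) ^ 2))).
{ apply filter_forall; intros z; now rewrite sqrt_pow2 by apply Cmod_ge_0. }
assert (E : Cdiff (fun z => RtoC (Cmod (z - p) ^ 2)) q (RtoC (2 * Re (q - p))) (RtoC (2 * Im (q - p)))).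
{ apply Cdiff_ext with (fun z => (z - p) * Cconj (z - p))%C.
  { apply filter_forall; intros z; symmetry; apply Cmod2_conj. }
  eapply Cdiff_eq.
  - apply Cdiff_mult; [|apply Cdiff_conj]; apply Cdiff_sub.
  - apply injective_projections; simpl; unfold Re, Im; simpl; ring.
  - apply injective_projections; simpl; unfold Re, Im; simpl; ring. }
eapply Cdiff_eq.
- apply (Cdiff_comp_R (fun z => Cmod (z - p) ^ 2) sqrt _ _ _ (/ (2 * sqrt (Cmod (q - p) ^ 2))) E).
  apply is_derive_Reals, derivable_pt_lim_sqrt, pow_lt, D.
- rewrite sqrt_pow2 by lra; rewrite <- RtoC_mult; f_equal; field; lra.
- rewrite sqrt_pow2 by lra; rewrite <- RtoC_mult; f_equal; field; lra.
Qed.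

(** The complex conjugate of [K] times the radial unit field around [p].  The
    divergence of that field is [1 / r], so the areolar derivative of [weight]
    is [K / r], while its modulus stays bounded by [K]: the integrable
    singularity [1 / r] is dominated by a bounded function. *)
Definition weight (K : R) (p z : C) : C := (RtoC K * (Cconj (z - p) * / RtoC (Cmod (z - p))))%C.

Lemma weight_bound K p z : 0 <= K -> Cmod (weight K p z) <= K.
Proof.
intros K0; unfold weight; rewrite !Cmod_mult, Cmod_conj, Cmod_R, (Rabs_pos_eq K) by easy.
destruct (Req_dec (Cmod (z - p)) 0) as [E|E].
- rewrite E, Rmult_0_l, Rmult_0_r; easy.
- assert (RtoC (Cmod (z - p)) <> 0) by (intros X; apply E; injection X; easy).
  rewrite Cmod_inv, Cmod_R, Rabs_pos_eq by (easy || apply Cmod_ge_0).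
  right; field; easy.
Qed.

Lemma weight_Cdiff K p q : q <> p -> exists al be,
  Cdiff (weight K p) q al be /\ (al + Ci * be)%C = RtoC (K / Cmod (q - p)).
Proof.
intros nq; generalize (proj1 (Cmod_gt_0 _) (Csub_neq _ _ nq)); intros D.
assert (nr : RtoC (Cmod (q - p)) <> 0) by (intros X; injection X; lra).
assert (Dc := Cdiff_conj _ _ _ _ (Cdiff_sub p q)).
assert (Di := Cdiff_inv _ _ _ _ (Cdiff_Cmod p q nq) nr).
assert (D1 := Cdiff_mult _ _ _ _ _ _ _ (Cdiff_const (RtoC K) q) (Cdiff_mult _ _ _ _ _ _ _ Dc Di)).
eexists; eexists; split; [exact D1|].
assert (E : (RtoC (Cmod (q - p)) * RtoC (Cmod (q - p)) = (q - p) * Cconj (q - p))%C).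
{ rewrite <- Cmod2_conj, RtoC_pow; ring. }
assert (E' : (RtoC (Re (q - p)) + Ci * RtoC (Im (q - p)) = q - p)%C) by (symmetry; apply C_split).
unfold Rdiv; rewrite !RtoC_mult, !RtoC_inv by lra.
set (r := RtoC (Cmod (q - p))) in *; set (w := (q - p)%C) in *.
transitivity (RtoC K * ((Cconj 1 + Ci * Cconj Ci) * / r - Cconj w * (RtoC (Re w) + Ci * RtoC (Im w)) / (r * r * r)))%C.
{ unfold Cdiv; field; easy. }
rewrite E'; replace (Cconj w * w)%C with (r * r)%C by (rewrite E; ring).
replace (Cconj 1 + Ci * Cconj Ci)%C with (1 + 1)%C by (apply injective_projections; simpl; ring).
field; easy.
Qed.

Lemma weight_dbar K p q : q <> p -> has_dbar (weight K p) q (RtoC (K / Cmod (q - p))).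
Proof.
intros nq; destruct (weight_Cdiff K p q nq) as (al & be & D & <-).
apply has_dbar_Cdiff; [|exact D].
generalize (locally_neq _ _ nq); apply filter_imp; intros z nz.
destruct (weight_Cdiff K p z nz) as (al' & be' & D' & _); now apply Cdiff_continuous in D'.
Qed.

(** The relation [be = Ci * al] between the partial derivatives is the
    Cauchy-Riemann equation. *)
Lemma kernel_Cdiff (p1 p2 q : C) : q <> p1 -> q <> p2 ->
  exists l, Cdiff (fun z => / ((z - p1) * (z - p2)))%C q l (Ci * l).
Proof.
intros n1 n2; eexists; eapply Cdiff_eq.
- apply (Cdiff_inv (fun z => (z - p1) * (z - p2))%C);
   [apply Cdiff_mult; apply Cdiff_sub|apply Cmult_neq_0; now apply Csub_neq].
- reflexivity.
- cbv beta; field; split; now apply Csub_neq.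
Qed.

Lemma kernel_mult_dbar (F : C -> C) (p1 p2 q G : C) : q <> p1 -> q <> p2 -> has_dbar F q G ->
  has_dbar (fun z => F z * / ((z - p1) * (z - p2)))%C q (G * / ((q - p1) * (q - p2))).
Proof.
intros n1 n2 HF; destruct (kernel_Cdiff p1 p2 q n1 n2) as [l Hl].
eapply has_dbar_eq; [apply has_dbar_mult; [exact HF| |exact Hl]|].
- generalize (filter_and _ _ (locally_neq _ _ n1) (locally_neq _ _ n2)); apply filter_imp.
  intros z [m1 m2]; destruct (kernel_Cdiff p1 p2 z m1 m2) as [k Hk].
  now apply Cdiff_continuous in Hk.
- replace (l + Ci * (Ci * l))%C with (RtoC 0) by (apply injective_projections; simpl; ring); ring.
Qed.

Lemma kernel_residue (F : C -> C) (p1 p2 : C) : p1 <> p2 -> continuous F p1 ->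
  forall eps, 0 < eps -> locally p1 (fun z => z <> p1 ->
    Cmod ((z - p1) * (F z * / ((z - p1) * (z - p2))) - F p1 / (p1 - p2)) <= eps).
Proof.
intros n12 HF eps e0.
assert (Hc : continuous (fun z => F z * / (z - p2))%C p1).
{ apply continuous_Cmult; [easy|apply continuous_Cinv; [|now apply Csub_neq]].
  apply continuous_Cminus; [apply continuous_id|apply continuous_Cconst]. }
generalize (filter_and _ _ (locally_neq _ _ n12) (proj1 (continuous_Cmod _ _) Hc _ e0)).
apply filter_imp; intros z [n2 Hz] n1.
replace ((z - p1) * (F z * / ((z - p1) * (z - p2))))%C with (F z * / (z - p2))%C;
  [exact Hz|field; split; now apply Csub_neq].
Qed.

(** The residues of [F q / ((q - z0) * (q - z))] at [z0] and [z] are [0] and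
    [F z / (z - z0)].  As the areolar derivative of [F] vanishes at [z0] to first
    order, the pole at [z0] is compensated, and that of the integrand is at most
    [K / Cmod (q - z)], the derivative of [weight K z]. *)
Lemma cauchy_pompeiu_quotient (F G : C -> C) (z0 z : C) R K :
  0 < R -> 0 <= K ->
  (forall q, box (Re z0 - R) (Re z0 + R) (Im z0 - R) (Im z0 + R) q ->
     has_dbar F q (G q) /\ Cmod (G q) <= K * Cmod (q - z0)) ->
  F z0 = 0 -> z <> z0 -> Cmod (z - z0) < R ->
  Cmod (rect_int (fun q => F q * / ((q - z0) * (q - z)))%C
          (Re z0 - R) (Re z0 + R) (Im z0 - R) (Im z0 + R)
        - F z / (z - z0) * (Ci * RtoC (2 * PI))) <= 16 * K * R.
Proof.
intros R0 K0 HF F0 nz Hz.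
set (B := box (Re z0 - R) (Re z0 + R) (Im z0 - R) (Im z0 + R)) in *.
assert (Bz0 : B z0) by (split; lra).
generalize (re_le_Cmod (z - z0)) (im_le_Cmod (z - z0)); rewrite Re_minus, Im_minus; intros X Y.
assert (X1 := Rle_lt_trans _ _ _ X Hz); assert (Y1 := Rle_lt_trans _ _ _ Y Hz).
apply Rabs_lt_between in X1; apply Rabs_lt_between in Y1.
assert (Bz : B z) by (split; lra).
assert (Fc : forall q, B q -> continuous F q) by (intros q Hq; eapply has_dbar_continuous, HF, Hq).
set (H := fun q => (F q * / ((q - z0) * (q - z)))%C).
set (g := fun q => (G q * / ((q - z0) * (q - z)))%C).
assert (h1 : forall q, B q -> q <> z0 -> q <> z -> has_dbar H q (g q)).
{ intros q Hq n0 n; apply kernel_mult_dbar; [easy|easy|now apply HF]. }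
assert (h2 : forall q, B q -> q <> z0 -> q <> z -> has_dbar (weight K z) q (RtoC (K / Cmod (q - z)))).
{ intros q Hq n0 n; now apply weight_dbar. }
assert (h3 : forall q, B q -> q <> z0 -> q <> z -> Cmod (g q) <= K / Cmod (q - z)).
{ intros q Hq n0 n; unfold g; apply Csub_neq in n0; apply Csub_neq in n.
  rewrite Cmod_mult, Cmod_inv, Cmod_mult by now apply Cmult_neq_0.
  apply Cmod_gt_0 in n0; apply Cmod_gt_0 in n.
  replace (K / Cmod (q - z)) with (K * Cmod (q - z0) * / (Cmod (q - z0) * Cmod (q - z))) by (field; lra).
  apply Rmult_le_compat_r; [apply Rlt_le, Rinv_0_lt_compat, Rmult_lt_0_compat; easy|now apply HF]. }
assert (r0 : forall eps, 0 < eps -> locally z0 (fun q => q <> z0 -> Cmod ((q - z0) * H q - 0) <= eps)).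
{ intros eps e0; generalize (kernel_residue F z0 z (not_eq_sym nz) (Fc _ Bz0) eps e0).
  rewrite F0; replace (0 / (z0 - z))%C with (RtoC 0); [easy|].
  field; apply Csub_neq; auto. }
assert (r1 : forall eps, 0 < eps -> locally z (fun q => q <> z -> Cmod ((q - z) * H q - F z / (z - z0)) <= eps)).
{ intros eps e0; generalize (kernel_residue F z z0 nz (Fc _ Bz) eps e0); apply filter_imp.
  intros q Hq n; unfold H; rewrite (Cmult_comm (q - z0) (q - z)); now apply Hq. }
assert (wb := weight_bound K z).
replace (16 * K * R) with (4 * K * ((Re z0 + R - (Re z0 - R)) + (Im z0 + R - (Im z0 - R)))) by ring.
assert (Cases : (Re z0 < Re z \/ Im z0 < Im z) \/ (Re z < Re z0 \/ Im z < Im z0)).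
{ destruct (Rtotal_order (Re z0) (Re z)) as [|[Er|]]; [tauto| |tauto].
  destruct (Rtotal_order (Im z0) (Im z)) as [|[Ei|]]; [tauto| |tauto].
  destruct nz; now apply injective_projections. }
destruct Cases as [Cs|Cs].
- replace (F z / (z - z0))%C with (0 + F z / (z - z0))%C by ring.
  apply (dbar_two_poles H (weight K z) g (fun q => K / Cmod (q - z)) z0 z); try easy; try lra.
  intros q; now apply wb.
- replace (F z / (z - z0))%C with (F z / (z - z0) + 0)%C by ring.
  apply (dbar_two_poles H (weight K z) g (fun q => K / Cmod (q - z)) z z0); try easy; try lra; auto.
Qed.

(** For fixed [R] the contour integral of the previous lemma depends in a
    Lipschitz way on [z]; the price is the error [K * R], small with [R]. *)
Lemma quotient_oscillation (F G : C -> C) (z0 z z' : C) R K M :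
  0 < R -> 0 <= K -> 
  (forall q, box (Re z0 - R) (Re z0 + R) (Im z0 - R) (Im z0 + R) q ->
     has_dbar F q (G q) /\ Cmod (G q) <= K * Cmod (q - z0) /\ Cmod (F q) <= M) ->
  F z0 = 0 -> z <> z0 -> z' <> z0 -> Cmod (z - z0) <= R / 2 -> Cmod (z' - z0) <= R / 2 ->
  Cmod (F z / (z - z0) - F z' / (z' - z0))
    <= 32 * K * R + 16 * M / R ^ 2 * (Cmod (z - z0) + Cmod (z' - z0)).
Proof.
intros R0 K0 HF F0 nz nz' Hz Hz'.
set (B := box (Re z0 - R) (Re z0 + R) (Im z0 - R) (Im z0 + R)) in *.
assert (P := cauchy_pompeiu_quotient F G z0 z R K R0 K0
  ltac:(intros q Hq; specialize (HF q Hq); tauto) F0 nz ltac:(lra)).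
assert (P' := cauchy_pompeiu_quotient F G z0 z' R K R0 K0
  ltac:(intros q Hq; specialize (HF q Hq); tauto) F0 nz' ltac:(lra)).
assert (off : forall q, frame (Re z0 - R) (Re z0 + R) (Im z0 - R) (Im z0 + R) q -> forall w, Cmod (w - z0) <= R / 2 ->
   R / 2 <= Cmod (q - w)).
{ intros q Hq w Hw; generalize (frame_pole_dist z0 R q R0 Hq) (Cmod_triangle (q - w) (w - z0)).
  replace (q - w + (w - z0))%C with (q - z0)%C by ring; lra. }
assert (off0 : forall q, frame (Re z0 - R) (Re z0 + R) (Im z0 - R) (Im z0 + R) q -> (q - z0)%C <> 0).
{ intros q Hq; apply Cmod_gt_0; generalize (frame_pole_dist z0 R q R0 Hq); lra. }
assert (offw : forall q, frame (Re z0 - R) (Re z0 + R) (Im z0 - R) (Im z0 + R) q -> forall w, Cmod (w - z0) <= R / 2 ->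
   (q - w)%C <> 0).
{ intros q Hq w Hw; apply Cmod_gt_0; generalize (off q Hq w Hw); lra. }
assert (cK : forall w, Cmod (w - z0) <= R / 2 ->
  cont_frame (fun q => F q * / ((q - z0) * (q - w)))%C (Re z0 - R) (Re z0 + R) (Im z0 - R) (Im z0 + R)).
{ intros w Hw q Hq; eapply has_dbar_continuous, kernel_mult_dbar; [| |eapply (HF q), Hq].
  - intros ->; apply (off0 _ Hq); ring.
  - intros ->; apply (offw _ Hq w Hw); ring. }
assert (M0 : 0 <= M) by (eapply Rle_trans; [apply (Cmod_ge_0 (F z0))|apply HF; split; lra]).
set (S := Cmod (z - z0) + Cmod (z' - z0)).
assert (S0 : 0 <= S) by (unfold S; generalize (Cmod_ge_0 (z - z0)) (Cmod_ge_0 (z' - z0)); lra).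
assert (Q : Cmod (rect_int (fun q => F q * / ((q - z0) * (q - z)) - F q * / ((q - z0) * (q - z')))%C
   (Re z0 - R) (Re z0 + R) (Im z0 - R) (Im z0 + R)) <= 32 * M / R ^ 2 * S).
{ apply Rle_trans with (2 * (M * (S * / (R * (R / 2 * (R / 2))))) * ((Re z0 + R - (Re z0 - R)) + (Im z0 + R - (Im z0 - R)))).
  2: right; field; lra.
  apply rect_bound; try lra.
  - intros q Hq; apply continuous_Cminus; now apply cK.
  - intros q Hq.
    replace (F q * / ((q - z0) * (q - z)) - F q * / ((q - z0) * (q - z')))%C with
     (F q * ((z - z') * / ((q - z0) * ((q - z) * (q - z')))))%C
     by (field; repeat split; try apply off0; try apply offw; easy).
    rewrite !Cmod_mult, Cmod_inv, !Cmod_mult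
     by (repeat apply Cmult_neq_0; try apply off0; try apply offw; easy).
    apply Rmult_le_compat; try apply Cmod_ge_0.
    + apply Rmult_le_pos; [apply Cmod_ge_0|]; apply Rlt_le, Rinv_0_lt_compat.
      generalize (frame_pole_dist z0 R q R0 Hq) (off q Hq z Hz) (off q Hq z' Hz'); intros.
      repeat apply Rmult_lt_0_compat; lra.
    + apply HF, Hq.
    + apply Rmult_le_compat; try apply Cmod_ge_0.
      * generalize (frame_pole_dist z0 R q R0 Hq) (off q Hq z Hz) (off q Hq z' Hz'); intros.
        apply Rlt_le, Rinv_0_lt_compat; repeat apply Rmult_lt_0_compat; lra.
      * replace (z - z')%C with ((z - z0) - (z' - z0))%C by ring.
        unfold Cminus at 1; eapply Rle_trans; [apply Cmod_triangle|]; rewrite Cmod_opp; right; easy.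
      * generalize (frame_pole_dist z0 R q R0 Hq) (off q Hq z Hz) (off q Hq z' Hz'); intros.
        apply Rinv_le_contravar; [repeat apply Rmult_lt_0_compat; lra|].
        apply Rmult_le_compat; try lra; [apply Rmult_le_pos; lra|].
        apply Rmult_le_compat; lra. }
rewrite rect_minus in Q by (lra || now apply cK).
set (D := (F z / (z - z0))%C) in *; set (D' := (F z' / (z' - z0))%C) in *.
set (I := rect_int _ _ _ _ _) in P, Q; set (I' := rect_int _ _ _ _ _) in P', Q.
assert (T : 2 * PI * Cmod (D - D') <= 32 * K * R + 32 * M / R ^ 2 * S).
{ replace (2 * PI * Cmod (D - D')) with (Cmod ((I - I') + (- (I - D * (Ci * RtoC (2 * PI))) + (I' - D' * (Ci * RtoC (2 * PI)))))).
  - eapply Rle_trans; [apply Cmod_triangle|]; eapply Rle_trans; [apply Rplus_le_compat_l, Cmod_triangle|].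
    rewrite Cmod_opp; lra.
  - replace (I - I' + (- (I - D * (Ci * RtoC (2 * PI))) + (I' - D' * (Ci * RtoC (2 * PI)))))%C
      with ((D - D') * (Ci * RtoC (2 * PI)))%C by ring.
    rewrite !Cmod_mult, Cmod_Ci, Cmod_R, Rabs_pos_eq; [ring|]; generalize PI_RGT_0; lra. }
assert (PI2 : 2 <= 2 * PI) by (generalize PI2_1; lra).
assert (2 * Cmod (D - D') <= 2 * PI * Cmod (D - D')) by (apply Rmult_le_compat_r; [apply Cmod_ge_0|easy]).
assert (0 <= K * R) by (apply Rmult_le_pos; lra).
apply Rmult_le_reg_l with 2; [lra|].
replace (2 * (32 * K * R + 16 * M / R ^ 2 * S)) with (64 * K * R + 32 * M / R ^ 2 * S) by (field; lra).
lra.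
Qed.

(** * Derivatives along segments *)
Lemma Cdiff_line_Re (h : C -> C) (x y dx dy t0 : R) (al be : C) :
  Cdiff h (x + t0 * dx, y + t0 * dy) al be ->
  is_derive (fun t => Re (h (x + t * dx, y + t * dy))) t0 (Re (al * RtoC dx + be * RtoC dy)).
Proof.
intros H; apply is_derive_Reals; intros eps e0.
set (N := Cmod (dx, dy) + 1).
assert (N0 : 0 < N) by (unfold N; generalize (Cmod_ge_0 (dx, dy)); lra).
assert (e1 : 0 < eps / (2 * N)) by (apply Rdiv_lt_0_compat; lra).
destruct (proj1 (locally_Cmod _ _) (H _ e1)) as [del [d0 Hd]].
exists (mkposreal _ (Rdiv_lt_0_compat _ _ d0 N0)); intros k k0 Hk; simpl in Hk.
set (p := ((x + t0 * dx, y + t0 * dy) : C)) in *.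
set (z := ((x + (t0 + k) * dx, y + (t0 + k) * dy) : C)).
assert (E : (z - p = RtoC k * (dx, dy))%C) by (apply injective_projections; simpl; ring).
assert (Ez : Cmod (z - p) = Rabs k * Cmod (dx, dy)) by now rewrite E, Cmod_mult, Cmod_R.
assert (B : Cmod (z - p) <= Rabs k * N).
{ rewrite Ez; apply Rmult_le_compat_l; [apply Rabs_pos|unfold N; lra]. }
assert (Hk' : 0 < Rabs k) by now apply Rabs_pos_lt.
apply Rlt_div_r in Hk; [|easy].
specialize (Hd z ltac:(lra)).
set (l := (al * RtoC dx + be * RtoC dy)%C).
replace ((Re (h z) - Re (h p)) / k - Re l) with (Re (h z - h p - RtoC k * l) / k).
2: { unfold Re; simpl; field; easy. }
unfold Rdiv; rewrite Rabs_mult, Rabs_inv.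
apply Rlt_div_l; [easy|]; apply Rle_lt_trans with (eps / 2 * Rabs k).
2: apply Rmult_lt_compat_r; lra.
eapply Rle_trans; [apply re_le_Cmod|].
apply Rle_trans with (eps / (2 * N) * (Rabs k * N)); [|right; field; lra].
apply Rle_trans with (eps / (2 * N) * Cmod (z - p)); [|apply Rmult_le_compat_l; lra].
replace (RtoC k * l)%C with (al * RtoC (Re z - Re p) + be * RtoC (Im z - Im p))%C; [exact Hd|].
unfold l, z, p; apply injective_projections; simpl; ring.
Qed.

Lemma Cdiff_line_Im (h : C -> C) (x y dx dy t0 : R) (al be : C) :
  Cdiff h (x + t0 * dx, y + t0 * dy) al be ->
  is_derive (fun t => Im (h (x + t * dx, y + t * dy))) t0 (Im (al * RtoC dx + be * RtoC dy)).
Proof.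
intros H.
assert (K := Cdiff_mult _ _ _ _ _ _ _ (Cdiff_const (- Ci)%C _) H).
apply Cdiff_line_Re in K.
assert (E : forall z, Re (- Ci * z) = Im z) by (intros z; unfold Re, Im; simpl; ring).
eapply is_derive_ext; [intros t; apply E|].
match type of K with is_derive _ _ ?l => replace (Im (al * RtoC dx + be * RtoC dy)) with l; [exact K|] end.
unfold Re, Im; simpl; ring.
Qed.

Lemma is_derive_Cdiff (h : C -> C) (x y : R) (al be : C) : Cdiff h (x, y) al be ->
  (is_derive (fun s => Re (h (s, y))) x (Re al) /\ is_derive (fun s => Im (h (s, y))) x (Im al)) /\
  (is_derive (fun t => Re (h (x, t))) y (Re be) /\ is_derive (fun t => Im (h (x, t))) y (Im be)).
Proof.
intros H.
assert (H1 : Cdiff h (0 + x * 1, y + x * 0) al be)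
  by (replace ((0 + x * 1, y + x * 0) : C) with ((x, y) : C) by (apply injective_projections; simpl; ring); easy).
assert (H2 : Cdiff h (x + y * 0, 0 + y * 1) al be)
  by (replace ((x + y * 0, 0 + y * 1) : C) with ((x, y) : C) by (apply injective_projections; simpl; ring); easy).
split; split.
- replace (Re al) with (Re (al * RtoC 1 + be * RtoC 0)) by (unfold Re; simpl; ring).
  eapply is_derive_ext; [|apply (Cdiff_line_Re _ _ _ _ _ _ _ _ H1)].
  intros t; simpl; do 2 f_equal; apply injective_projections; simpl; ring.
- replace (Im al) with (Im (al * RtoC 1 + be * RtoC 0)) by (unfold Im; simpl; ring).
  eapply is_derive_ext; [|apply (Cdiff_line_Im _ _ _ _ _ _ _ _ H1)].
  intros t; simpl; do 2 f_equal; apply injective_projections; simpl; ring.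
- replace (Re be) with (Re (al * RtoC 0 + be * RtoC 1)) by (unfold Re; simpl; ring).
  eapply is_derive_ext; [|apply (Cdiff_line_Re _ _ _ _ _ _ _ _ H2)].
  intros t; simpl; do 2 f_equal; apply injective_projections; simpl; ring.
- replace (Im be) with (Im (al * RtoC 0 + be * RtoC 1)) by (unfold Im; simpl; ring).
  eapply is_derive_ext; [|apply (Cdiff_line_Im _ _ _ _ _ _ _ _ H2)].
  intros t; simpl; do 2 f_equal; apply injective_projections; simpl; ring.
Qed.

Lemma ball_segment (p z w : C) r t : 0 <= t <= 1 -> Cmod (z - p) < r -> Cmod (w - p) < r ->
  Cmod ((Re w + t * (Re z - Re w), Im w + t * (Im z - Im w))%R - p) < r.
Proof.
intros Ht Hz Hw.
replace (((Re w + t * (Re z - Re w), Im w + t * (Im z - Im w))%R : C) - p)%C with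
  (RtoC t * (z - p) + RtoC (1 - t) * (w - p))%C
  by (apply injective_projections; simpl; unfold Re, Im; ring).
eapply Rle_lt_trans; [apply Cmod_triangle|]; rewrite !Cmod_mult, !Cmod_R, !Rabs_pos_eq by lra.
destruct (Req_dec t 0) as [->|]; [lra|].
apply Rlt_le_trans with (t * r + (1 - t) * r); [|lra].
apply Rplus_lt_le_compat; [apply Rmult_lt_compat_l; lra|apply Rmult_le_compat_l; lra].
Qed.

Lemma Cdiff_locally_lipschitz (h hx hy : C -> C) (p : C) :
  locally p (fun z => Cdiff h z (hx z) (hy z)) -> continuous hx p -> continuous hy p ->
  exists r L, 0 < r /\ 0 <= L /\ forall z w, Cmod (z - p) < r -> Cmod (w - p) < r ->
    Cmod (h z - h w) <= L * Cmod (z - w).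
Proof.
intros Hd Hx Hy.
destruct (proj1 (locally_Cmod _ _) (filter_and _ _ Hd
  (filter_and _ _ (locally_bounded _ _ Hx) (locally_bounded _ _ Hy)))) as [r [r0 Hr]].
set (L := Cmod (hx p) + 1 + (Cmod (hy p) + 1)).
assert (L0 : 0 <= L) by (unfold L; generalize (Cmod_ge_0 (hx p)) (Cmod_ge_0 (hy p)); lra).
exists r, (2 * L); split; [easy|]; split; [lra|]; intros z w Hz Hw.
set (dx := Re z - Re w); set (dy := Im z - Im w).
assert (Hl : forall t, 0 <= t <= 1 ->
  Cmod (hx (Re w + t * dx, Im w + t * dy) * RtoC dx + hy (Re w + t * dx, Im w + t * dy) * RtoC dy)
    <= L * Cmod (z - w)).
{ intros t Ht; destruct (Hr _ (ball_segment p z w r t Ht Hz Hw)) as (_ & B1 & B2).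
  eapply Rle_trans; [apply linear_bound|]; apply Rmult_le_compat_r; [apply Cmod_ge_0|].
  apply Rplus_le_compat; assumption. }
assert (E1 : (Re w + 1 * dx, Im w + 1 * dy) = z)
  by (apply injective_projections; unfold dx, dy, Re, Im; simpl; ring).
assert (E0 : (Re w + 0 * dx, Im w + 0 * dy) = w)
  by (apply injective_projections; unfold dx, dy, Re, Im; simpl; ring).
(* The mean value theorem is applied to the real and imaginary parts
   separately, whence the factor 2 in the Lipschitz constant. *)
assert (M : forall (g : R -> R) dg, (forall t, 0 <= t <= 1 -> is_derive g t (dg t) /\ Rabs (dg t) <= L * Cmod (z - w)) ->
   Rabs (g 1 - g 0) <= L * Cmod (z - w)).
{ intros g dg Hg; destruct (MVT_gen g 0 1 dg) as [c [Hc ->]].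
  - rewrite Rmin_left, Rmax_right by lra; intros t Ht; apply Hg; lra.
  - rewrite Rmin_left, Rmax_right by lra; intros t Ht; apply continuity_pt_filterlim.
    apply (ex_derive_continuous (V := R_NormedModule)); exists (dg t); now apply Hg.
  - rewrite Rmin_left, Rmax_right in Hc by lra; rewrite Rminus_0_r, Rmult_1_r; now apply Hg. }
assert (M1 := M (fun t => Re (h (Re w + t * dx, Im w + t * dy)))
  (fun t => Re (hx (Re w + t * dx, Im w + t * dy) * RtoC dx + hy (Re w + t * dx, Im w + t * dy) * RtoC dy))).
assert (M2 := M (fun t => Im (h (Re w + t * dx, Im w + t * dy)))
  (fun t => Im (hx (Re w + t * dx, Im w + t * dy) * RtoC dx + hy (Re w + t * dx, Im w + t * dy) * RtoC dy))).
cbv beta in M1, M2; rewrite E1, E0 in M1, M2.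
replace (h z - h w)%C with ((Re (h z) - Re (h w), Im (h z) - Im (h w))%R : C)
  by (apply injective_projections; simpl; unfold Re, Im; ring).
eapply Rle_trans; [apply Cmod_pair_le|].
replace (2 * L * Cmod (z - w)) with (L * Cmod (z - w) + L * Cmod (z - w)) by ring.
apply Rplus_le_compat; [apply M1|apply M2]; intros t Ht; split.
- apply Cdiff_line_Re, Hr, (ball_segment p z w r t Ht Hz Hw).
- eapply Rle_trans; [apply re_le_Cmod|now apply Hl].
- apply Cdiff_line_Im, Hr, (ball_segment p z w r t Ht Hz Hw).
- eapply Rle_trans; [apply im_le_Cmod|now apply Hl].
Qed.

(** * Functions with a suitable areolar derivative are continuously differentiable *)
Lemma cauchy_limit (D : C -> C) (z0 : C) :
  (forall eps, 0 < eps -> exists del, 0 < del /\ forall z z', z <> z0 -> z' <> z0 ->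
     Cmod (z - z0) < del -> Cmod (z' - z0) < del -> Cmod (D z - D z') <= eps) ->
  exists A, forall eps, 0 < eps -> locally z0 (fun z => z <> z0 -> Cmod (D z - A) <= eps).
Proof.
intros H.
assert (PF : ProperFilter (within (fun z : C => z <> z0) (locally z0))).
{ apply Build_ProperFilter; [|apply within_filter, locally_filter].
  intros P HP; destruct (proj1 (locally_Cmod _ _) HP) as [d [d0 Hd]].
  assert (E : (z0 + RtoC (d / 2) - z0 = RtoC (d / 2))%C) by ring.
  exists (z0 + RtoC (d / 2))%C; apply Hd.
  - rewrite E, Cmod_R, Rabs_pos_eq; lra.
  - intros E'; rewrite E' in E; replace (z0 - z0)%C with (RtoC 0) in E by ring.
    injection E; lra. }
destruct (proj1 (filterlim_locally_cauchy (U := C_R_CompleteNormedModule) D)) as [A HA].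
- intros [eps e0]; assert (e1 : 0 < eps / 2) by lra; destruct (H _ e1) as [del [d0 Hd]].
  exists (fun z => z <> z0 /\ Cmod (z - z0) < del); split.
  + apply locally_Cmod; exists del; split; easy.
  + intros z z' [] []; apply C_NormedModule_mixin_compat1; simpl.
    change (Cmod (D z' - D z) < eps); rewrite Cmod_minus_sym.
    apply Rle_lt_trans with (eps / 2); [now apply Hd|lra].
- exists A; intros eps e0.
  assert (L : locally A (fun y => Cmod (y - A) <= eps)) by now apply locally_small.
  exact (HA _ L).
Qed.

(** The function [v] is only known to be continuous.  For every centre [z0] a
    differentiable correction, vanishing at [z0], gives it an areolar derivative
    that vanishes at [z0] to first order.  Boundedness of the areolar derivative
    of [v] itself would not make [v] differentiable; after the correction the
    difference quotients at [z0] converge, uniformly in [z0]. *)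
Section Regularity.
Variables (U : C -> Prop) (v a psi gam psix psiy : C -> C).
Hypothesis U_open : open U.
Hypothesis v_cont : forall z, U z -> continuous v z.
Hypothesis a_diff : forall z, U z -> exists a1 a2, Cdiff a z a1 a2.
Hypothesis gam_cont : forall z, U z -> continuous gam z.
Hypothesis psi_C1 : forall z, U z -> Cdiff psi z (psix z) (psiy z) /\ continuous psix z /\ continuous psiy z.
Hypothesis v_dbar : forall z0 z, U z0 -> U z ->
  has_dbar (fun q => v q - a q * (psi q - psi z0))%C z (gam z * (psi z - psi z0))%C.

Lemma psi_cont z : U z -> continuous psi z.
Proof. intros Uz; exact (Cdiff_continuous _ _ _ _ (proj1 (psi_C1 z Uz))). Qed.

Let F (z0 q : C) : C := (v q - v z0 - a q * (psi q - psi z0))%C.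

(** The constants [K] and [M] can be chosen uniformly for the centres [z0] near
    [p], hence so can the modulus of convergence. *)
Lemma quotient_cauchy (p : C) : U p -> exists r, 0 < r /\
  (forall z, Cmod (z - p) < r -> U z) /\
  forall eps, 0 < eps -> exists del, 0 < del /\ forall z0, Cmod (z0 - p) < r ->
   forall z z', z <> z0 -> z' <> z0 -> Cmod (z - z0) < del -> Cmod (z' - z0) < del ->
     Cmod (F z0 z / (z - z0) - F z0 z' / (z' - z0)) <= eps.
Proof.
intros Up.
assert (UL := U_open p Up).
destruct (psi_C1 p Up) as (_ & cx & cy).
destruct (Cdiff_locally_lipschitz psi psix psiy p) as (r1 & L & r1p & L0 & HL); try easy.
{ revert UL; apply filter_imp; intros z Hz; now apply psi_C1. }
destruct (a_diff p Up) as (a1 & a2 & Da); apply Cdiff_continuous in Da.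
destruct (proj1 (locally_Cmod _ _) (filter_and _ _ UL (filter_and _ _ (locally_bounded _ _ (v_cont p Up))
  (filter_and _ _ (locally_bounded _ _ Da) (locally_bounded _ _ (gam_cont p Up)))))) as (r2 & r2p & Hr2).
set (V := Cmod (v p) + 1) in Hr2; set (Ab := Cmod (a p) + 1) in Hr2; set (Gb := Cmod (gam p) + 1) in Hr2.
assert (0 <= V) by (unfold V; generalize (Cmod_ge_0 (v p)); lra).
assert (0 <= Ab) by (unfold Ab; generalize (Cmod_ge_0 (a p)); lra).
assert (0 <= Gb) by (unfold Gb; generalize (Cmod_ge_0 (gam p)); lra).
set (r := Rmin r1 r2); assert (r0 : 0 < r) by now apply Rmin_glb_lt.
generalize (Rmin_l r1 r2) (Rmin_r r1 r2); fold r; intros rl rr.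
set (K := Gb * L); assert (K0 : 0 <= K) by now apply Rmult_le_pos.
(* [M] bounds [F z0] on the disc of radius [r] around [p]; the squares of
   half side [R <= r / 8] around the centres [z0] stay inside that disc. *)
set (M := V + V + Ab * (L * (2 * r))).
assert (M0 : 0 <= M) by (unfold M; assert (0 <= Ab * (L * (2 * r))) by (repeat apply Rmult_le_pos; lra); lra).
exists (r / 2); split; [lra|]; split; [intros z Hz; apply Hr2; lra|]; intros eps e0.
set (R := Rmin (r / 8) (eps / (64 * K + 1))).
assert (e1 : 0 < eps / (64 * K + 1)) by (apply Rdiv_lt_0_compat; lra).
assert (R0 : 0 < R) by (apply Rmin_glb_lt; lra).
generalize (Rmin_l (r / 8) (eps / (64 * K + 1))) (Rmin_r (r / 8) (eps / (64 * K + 1))); fold R; intros Rl Rr.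
set (N := 64 * M / R ^ 2 + 1).
assert (R2 : 0 < R ^ 2) by now apply pow_lt.
assert (N0 : 0 < N) by (unfold N; assert (0 <= 64 * M / R ^ 2) by (apply Rdiv_le_0_compat; lra); lra).
set (del := Rmin (R / 2) (eps / N)).
assert (d0 : 0 < del) by (apply Rmin_glb_lt; [lra|now apply Rdiv_lt_0_compat]).
generalize (Rmin_l (R / 2) (eps / N)) (Rmin_r (R / 2) (eps / N)); fold del; intros dl dr.
exists del; split; [easy|]; intros z0 Hz0 z z' nz nz' Hz Hz'.
eapply Rle_trans; [apply (quotient_oscillation (F z0) (fun q => gam q * (psi q - psi z0))%C z0 z z' R K M)|];
  try easy; try lra.
- intros q Hq.
  assert (Bz0 : box (Re z0 - R) (Re z0 + R) (Im z0 - R) (Im z0 + R) z0) by (split; lra).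
  assert (Hq0 := box_dist _ _ _ _ _ _ Bz0 Hq).
  assert (Hqp : Cmod (q - p) < r).
  { replace (q - p)%C with ((q - z0) + (z0 - p))%C by ring.
    eapply Rle_lt_trans; [apply Cmod_triangle|]; lra. }
  destruct (Hr2 q ltac:(lra)) as (Uq & Vq & Aq & Gq).
  destruct (Hr2 z0 ltac:(lra)) as (Uz0 & Vz0 & _ & _).
  assert (Lq := HL q z0 ltac:(lra) ltac:(lra)).
  split; [|split].
  + eapply has_dbar_eq; [eapply has_dbar_ext; [|apply has_dbar_plus; [apply (v_dbar z0 q Uz0 Uq)|
     apply (has_dbar_Cdiff (fun _ => - v z0)%C); [|apply Cdiff_const]]]|].
    * apply filter_forall; intros y; unfold F; ring.
    * apply filter_forall; intros y; apply continuous_Cconst.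
    * ring.
  + rewrite Cmod_mult; unfold K; rewrite Rmult_assoc; apply Rmult_le_compat; try apply Cmod_ge_0; easy.
  + unfold F, Cminus; eapply Rle_trans; [apply Cmod_triangle|].
    rewrite Cmod_opp, Cmod_mult; apply Rplus_le_compat.
    * eapply Rle_trans; [apply Cmod_triangle|]; rewrite Cmod_opp; now apply Rplus_le_compat.
    * apply Rmult_le_compat; try apply Cmod_ge_0; [easy|].
      apply (Rle_trans _ _ _ Lq), Rmult_le_compat_l; [easy|].
      replace (q - z0)%C with ((q - p) + - (z0 - p))%C by ring.
      eapply Rle_trans; [apply Cmod_triangle|]; rewrite Cmod_opp; lra.
- unfold F; ring.
- apply Rle_trans with (32 * K * (eps / (64 * K + 1)) + 16 * M / R ^ 2 * (eps / N + eps / N)).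
  + apply Rplus_le_compat; apply Rmult_le_compat_l; try lra.
    apply Rdiv_le_0_compat; lra.
  + apply Rle_trans with (eps / 2 + eps / 2); [|lra]; apply Rplus_le_compat.
    * replace (eps / 2) with ((64 * K + 1) / 2 * (eps / (64 * K + 1))) by (field; lra).
      apply Rmult_le_compat_r; lra.
    * replace (16 * M / R ^ 2) with ((N - 1) / 4) by (unfold N; field; lra).
      replace (eps / 2) with (N / 4 * (eps / N + eps / N)) by (field; lra).
      apply Rmult_le_compat_r; [|lra].
      assert (0 < eps / N) by now apply Rdiv_lt_0_compat. lra.
Qed.

Let A (z0 : C) : C := epsilon (inhabits (RtoC 0)) (fun A =>
  forall eps, 0 < eps -> locally z0 (fun z => z <> z0 -> Cmod (F z0 z / (z - z0) - A) <= eps)).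

Lemma quotient_limit z0 : U z0 -> forall eps, 0 < eps ->
  locally z0 (fun z => z <> z0 -> Cmod (F z0 z / (z - z0) - A z0) <= eps).
Proof.
intros U0; apply (epsilon_spec (inhabits (RtoC 0)) (fun A =>
  forall eps, 0 < eps -> locally z0 (fun z => z <> z0 -> Cmod (F z0 z / (z - z0) - A) <= eps))).
apply cauchy_limit; intros eps e0.
destruct (quotient_cauchy z0 U0) as (r & r0 & _ & H); destruct (H eps e0) as (del & d0 & Hd).
exists del; split; [easy|]; apply Hd.
replace (z0 - z0)%C with (RtoC 0) by ring; now rewrite Cmod_0.
Qed.

Lemma quotient_limit_uniform (p : C) : U p -> exists r, 0 < r /\
  (forall z, Cmod (z - p) < r -> U z) /\
  forall eps, 0 < eps -> exists del, 0 < del /\ forall z0, Cmod (z0 - p) < r ->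
   forall z, z <> z0 -> Cmod (z - z0) < del -> Cmod (F z0 z / (z - z0) - A z0) <= eps.
Proof.
intros Up; destruct (quotient_cauchy p Up) as (r & r0 & HU & H).
exists r; split; [easy|]; split; [easy|]; intros eps e0.
assert (e1 : 0 < eps / 2) by lra.
destruct (H _ e1) as (del & d0 & Hd); exists del; split; [easy|].
intros z0 Hz0 z nz Hz.
destruct (proj1 (locally_Cmod _ _) (quotient_limit z0 (HU _ Hz0) _ e1)) as (d1 & d1p & H1).
set (s := Rmin del d1 / 2).
assert (0 < Rmin del d1) by now apply Rmin_glb_lt.
generalize (Rmin_l del d1) (Rmin_r del d1); intros.
assert (E : (z0 + RtoC s - z0 = RtoC s)%C) by ring.
assert (Cs : Cmod (z0 + RtoC s - z0) = s) by (rewrite E, Cmod_R, Rabs_pos_eq; [easy|unfold s; lra]).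
assert (ns : (z0 + RtoC s)%C <> z0).
{ intros E'; rewrite E' in Cs; replace (z0 - z0)%C with (RtoC 0) in Cs by ring.
  rewrite Cmod_0 in Cs; unfold s in Cs; lra. }
specialize (Hd z0 Hz0 z (z0 + RtoC s)%C nz ns Hz ltac:(rewrite Cs; unfold s; lra)).
specialize (H1 (z0 + RtoC s)%C ltac:(rewrite Cs; unfold s; lra) ns).
set (X := (F z0 z / (z - z0))%C) in *; set (Y := (F z0 (z0 + RtoC s) / (z0 + RtoC s - z0))%C) in *.
replace (X - A z0)%C with ((X - Y) + (Y - A z0))%C by ring.
eapply Rle_trans; [apply Cmod_triangle|]; lra.
Qed.

(** For a fixed increment the difference quotient is continuous in the centre,
    and the limit is uniform. *)
Lemma quotient_limit_continuous p : U p -> continuous A p.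
Proof.
intros Up; apply continuous_Cmod; intros eps e0.
destruct (quotient_limit_uniform p Up) as (r & r0 & HU & H).
assert (e1 : 0 < eps / 3) by lra.
destruct (H _ e1) as (del & d0 & Hd).
set (s := Rmin r del / 2).
assert (0 < Rmin r del) by now apply Rmin_glb_lt.
generalize (Rmin_l r del) (Rmin_r r del); intros.
assert (s0 : 0 < s) by (unfold s; lra).
assert (ns : forall z0, (z0 + RtoC s)%C <> z0).
{ intros z0 E; apply (f_equal (fun z => z - z0)%C) in E.
  replace (z0 + RtoC s - z0)%C with (RtoC s) in E by ring.
  replace (z0 - z0)%C with (RtoC 0) in E by ring; injection E; lra. }
assert (Cs : forall z0, Cmod (z0 + RtoC s - z0) = s).
{ intros z0; replace (z0 + RtoC s - z0)%C with (RtoC s) by ring; rewrite Cmod_R, Rabs_pos_eq; lra. }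
assert (Us : U (p + RtoC s)%C) by (apply HU; rewrite Cs; unfold s; lra).
assert (Qc : continuous (fun z0 => F z0 (z0 + RtoC s) / (z0 + RtoC s - z0))%C p).
{ apply continuous_ext with (fun z0 => F z0 (z0 + RtoC s) * / RtoC s)%C.
  { intros z; replace (z + RtoC s - z)%C with (RtoC s) by ring; easy. }
  assert (sh : forall h : C -> C, continuous h (p + RtoC s)%C -> continuous (fun z => h (z + RtoC s)%C) p).
  { intros h Hh; apply (continuous_comp (fun z => z + RtoC s)%C h); [|easy].
    apply continuous_Cplus; [apply continuous_id|apply continuous_Cconst]. }
  destruct (a_diff _ Us) as (? & ? & Da); apply Cdiff_continuous in Da.
  apply continuous_Cmult; [|apply continuous_Cconst]; unfold F.
  apply continuous_Cminus; [apply continuous_Cminus; [apply sh|]; now apply v_cont|].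
  apply continuous_Cmult; [now apply sh|].
  apply continuous_Cminus; [now apply sh, psi_cont|now apply psi_cont]. }
assert (r2 : 0 < r / 2) by lra.
generalize (filter_and _ _ (locally_small p (r / 2) r2) (proj1 (continuous_Cmod _ _) Qc _ e1)).
apply filter_imp; intros z [Hz Q].
assert (E1 := Hd z ltac:(lra) _ (ns z) ltac:(rewrite Cs; unfold s; lra)).
assert (E2 := Hd p ltac:(replace (p - p)%C with (RtoC 0) by ring; rewrite Cmod_0; lra) _ (ns p) ltac:(rewrite Cs; unfold s; lra)).
cbv beta in Q.
set (X := (F z (z + RtoC s) / (z + RtoC s - z))%C) in *; set (Y := (F p (p + RtoC s) / (p + RtoC s - p))%C) in *.
replace (A z - A p)%C with (- (X - A z) + ((X - Y) + (Y - A p)))%C by ring.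
eapply Rle_trans; [apply Cmod_triangle|]; eapply Rle_trans; [apply Rplus_le_compat_l, Cmod_triangle|].
rewrite Cmod_opp; lra.
Qed.

Lemma remainder_Cdiff z0 : U z0 -> Cdiff (F z0) z0 (A z0) (Ci * A z0).
Proof.
intros U0 eps e0; generalize (quotient_limit z0 U0 eps e0); apply filter_imp; intros z Hz.
assert (F0 : F z0 z0 = 0) by (unfold F; ring); rewrite F0.
replace (A z0 * RtoC (Re z - Re z0) + Ci * A z0 * RtoC (Im z - Im z0))%C with (A z0 * (z - z0))%C.
2: { rewrite (C_split (z - z0)), Re_minus, Im_minus; ring. }
destruct (classic (z = z0)) as [->|nz].
- rewrite F0; replace (0 - 0 - A z0 * (z0 - z0))%C with (RtoC 0) by ring; rewrite Cmod_0.
  apply Rmult_le_pos; [lra|apply Cmod_ge_0].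
- specialize (Hz nz).
  replace (F z0 z - 0 - A z0 * (z - z0))%C with ((F z0 z / (z - z0) - A z0) * (z - z0))%C
    by (field; now apply Csub_neq).
  rewrite Cmod_mult; apply Rmult_le_compat_r; [apply Cmod_ge_0|easy].
Qed.

Theorem pompeiu_C1 : exists vx vy : C -> C, forall z, U z ->
  Cdiff v z (vx z) (vy z) /\ continuous vx z /\ continuous vy z.
Proof.
exists (fun z => A z + a z * psix z)%C, (fun z => Ci * A z + a z * psiy z)%C; intros z0 U0.
destruct (a_diff _ U0) as (a1 & a2 & Da); destruct (psi_C1 _ U0) as (Dp & cx & cy).
assert (Dc := Cdiff_continuous _ _ _ _ Da); assert (Ac := quotient_limit_continuous _ U0).
split; [|split].
- apply Cdiff_ext with (fun q => F z0 q + (a q * (psi q + - psi z0) + v z0))%C.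
  { apply filter_forall; intros q; unfold F; ring. }
  eapply Cdiff_eq.
  + apply Cdiff_plus; [now apply remainder_Cdiff|]; apply Cdiff_plus; [|apply Cdiff_const].
    apply Cdiff_mult; [exact Da|]; apply Cdiff_plus; [exact Dp|apply Cdiff_const].
  + cbv beta; ring.
  + cbv beta; ring.
- apply continuous_Cplus; [easy|now apply continuous_Cmult].
- apply continuous_Cplus; [apply continuous_Cmult; [apply continuous_Cconst|easy]|now apply continuous_Cmult].
Qed.
End Regularity.

(** * Continuously differentiable functions on an open set *)
Lemma continuity_2d_pt_C (g : C -> R) (x y : R) :
  continuity_2d_pt (fun s t => g (s, t)) x y <-> continuous (fun z => RtoC (g z)) (x, y).
Proof.
split.
- intros H; apply continuous_Cmod; intros eps e0.
  generalize (proj1 (locally_2d_locally _ _ _) (H (mkposreal _ e0))); apply filter_imp.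
  intros [s t] Hz; simpl in Hz; rewrite <- RtoC_minus, Cmod_R; apply Rlt_le, Hz.
- intros H [eps e0]; apply locally_2d_locally; simpl.
  assert (e1 : 0 < eps / 2) by lra.
  generalize (proj1 (continuous_Cmod _ _) H _ e1); apply filter_imp.
  intros [s t] Hz; simpl; rewrite <- RtoC_minus, Cmod_R in Hz; lra.
Qed.

Lemma Cn_on_1_spec (Omega : C -> Prop) (g : C -> R) : open Omega -> Cn_on 1 Omega g ->
  forall z, Omega z ->
    Cdiff (fun q => RtoC (g q)) z (RtoC (pdx g z)) (RtoC (pdy g z)) /\
    continuous (fun q => RtoC (pdx g q)) z /\ continuous (fun q => RtoC (pdy g q)) z.
Proof.
intros Op H [x y] Hz.
destruct (H x y Hz) as (_ & _ & ey & (cx & _) & (cy & _)).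
split; [|split; [now apply (continuity_2d_pt_C (pdx g))|now apply (continuity_2d_pt_C (pdy g))]].
assert (D : differentiable_pt_lim (fun s t => g (s, t)) x y (pdx g (x, y)) (pdy g (x, y))).
{ apply filterdiff_differentiable_pt_lim.
  apply (is_derive_filterdiff (fun s t => g (s, t)) x y (fun s t => pdx g (s, t))).
  - generalize (Op _ Hz); apply filter_imp; intros [s t] Hst; apply Derive_correct.
    now apply (H s t Hst).
  - apply Derive_correct, ey.
  - apply (continuity_2d_pt_filterlim (fun s t => pdx g (s, t))), cx. }
intros eps e0; generalize (proj1 (locally_2d_locally _ _ _) (D (mkposreal _ e0))); apply filter_imp.
intros [s t] Hst; simpl in Hst.
replace (RtoC (g (s, t)) - RtoC (g (x, y)) - (RtoC (pdx g (x, y)) * RtoC (Re (s, t) - Re (x, y))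
   + RtoC (pdy g (x, y)) * RtoC (Im (s, t) - Im (x, y))))%C with
  (RtoC (g (s, t) - g (x, y) - (pdx g (x, y) * (s - x) + pdy g (x, y) * (t - y)))).
2: { apply injective_projections; simpl; ring. }
rewrite Cmod_R; apply (Rle_trans _ _ _ Hst); apply Rmult_le_compat_l; [lra|].
apply (Rmax_Cmod ((s, t) - (x, y))%C).
Qed.

Lemma C1_on_spec (Omega : C -> Prop) (w : C -> C) : open Omega -> C1_on Omega w ->
  forall z, Omega z -> Cdiff w z (cpdx w z) (cpdy w z) /\
    continuous (cpdx w) z /\ continuous (cpdy w) z.
Proof.
intros Op [H1 H2] z Hz.
destruct (Cn_on_1_spec _ _ Op H1 z Hz) as (d1 & cx1 & cy1).
destruct (Cn_on_1_spec _ _ Op H2 z Hz) as (d2 & cx2 & cy2).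
assert (E : forall g1 g2 : C -> R, forall q, (RtoC (g1 q) + Ci * RtoC (g2 q))%C = (g1 q, g2 q))
  by (intros; apply injective_projections; simpl; ring).
split; [|split].
- apply Cdiff_ext with (fun q => RtoC (Re (w q)) + Ci * RtoC (Im (w q)))%C.
  { apply filter_forall; intros q; symmetry; apply C_split. }
  eapply Cdiff_eq; [apply Cdiff_plus; [exact d1|apply Cdiff_mult; [apply Cdiff_const|exact d2]]|..];
    unfold cpdx, cpdy; apply injective_projections; simpl; ring.
- apply continuous_ext with (fun q => RtoC (pdx (fun s => Re (w s)) q) + Ci * RtoC (pdx (fun s => Im (w s)) q))%C.
  { intros q; apply E. }
  apply continuous_Cplus; [easy|apply continuous_Cmult; [apply continuous_Cconst|easy]].
- apply continuous_ext with (fun q => RtoC (pdy (fun s => Re (w s)) q) + Ci * RtoC (pdy (fun s => Im (w s)) q))%C.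
  { intros q; apply E. }
  apply continuous_Cplus; [easy|apply continuous_Cmult; [apply continuous_Cconst|easy]].
Qed.

Lemma cpdx_cpdy_Cdiff (h : C -> C) z al be : Cdiff h z al be -> cpdx h z = al /\ cpdy h z = be.
Proof.
destruct z as [x y]; intros H; destruct (is_derive_Cdiff _ _ _ _ _ H) as ((h1 & h2) & (h3 & h4)).
split; apply injective_projections.
- exact (is_derive_unique _ _ _ h1).
- exact (is_derive_unique _ _ _ h2).
- exact (is_derive_unique _ _ _ h3).
- exact (is_derive_unique _ _ _ h4).
Qed.

Lemma continuous_Re (h : C -> C) p : continuous h p -> continuous (fun z => RtoC (Re (h z))) p.
Proof.
intros H; apply continuous_Cmod; intros eps e0.
generalize (proj1 (continuous_Cmod _ _) H _ e0); apply filter_imp; intros z Hz.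
rewrite <- RtoC_minus, Cmod_R, <- Re_minus; eapply Rle_trans; [apply re_le_Cmod|easy].
Qed.

Lemma continuous_Im (h : C -> C) p : continuous h p -> continuous (fun z => RtoC (Im (h z))) p.
Proof.
intros H; apply continuous_Cmod; intros eps e0.
generalize (proj1 (continuous_Cmod _ _) H _ e0); apply filter_imp; intros z Hz.
rewrite <- RtoC_minus, Cmod_R, <- Im_minus; eapply Rle_trans; [apply im_le_Cmod|easy].
Qed.

Lemma C1_on_intro (Omega : C -> Prop) (h hx hy : C -> C) : open Omega ->
  (forall z, Omega z -> Cdiff h z (hx z) (hy z) /\ continuous hx z /\ continuous hy z) ->
  C1_on Omega h.
Proof.
intros Op H.
assert (P : forall z, Omega z -> continuous h z /\ continuous (cpdx h) z /\ continuous (cpdy h) z).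
{ intros z Hz; destruct (H z Hz) as (D & cx & cy); split; [eapply Cdiff_continuous, D|].
  assert (L : locally z (fun q => cpdx h q = hx q /\ cpdy h q = hy q)).
  { generalize (Op z Hz); apply filter_imp; intros q Hq; now apply cpdx_cpdy_Cdiff, H. }
  split; [apply (continuous_ext_loc _ hx)|apply (continuous_ext_loc _ hy)]; try easy;
   revert L; apply filter_imp; intros q [E1 E2]; auto. }
split; intros x y Hz; destruct (P _ Hz) as (ch & cx & cy); destruct (H _ Hz) as (D & _ & _);
  destruct (is_derive_Cdiff _ _ _ _ _ D) as ((h1 & h2) & (h3 & h4)).
- split; [apply (continuity_2d_pt_C (fun z => Re (h z))); now apply continuous_Re|].
  split; [eexists; exact h1|]; split; [eexists; exact h3|]; split; (split; [|easy]).
  + apply (continuity_2d_pt_C (fun z => Re (cpdx h z))); now apply continuous_Re.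
  + apply (continuity_2d_pt_C (fun z => Re (cpdy h z))); now apply continuous_Re.
- split; [apply (continuity_2d_pt_C (fun z => Im (h z))); now apply continuous_Im|].
  split; [eexists; exact h2|]; split; [eexists; exact h4|]; split; (split; [|easy]).
  + apply (continuity_2d_pt_C (fun z => Im (cpdx h z))); now apply continuous_Im.
  + apply (continuity_2d_pt_C (fun z => Im (cpdy h z))); now apply continuous_Im.
Qed.

Lemma CInt_hor_C1 w wx wy a b y : a <= b ->
  (forall x, a <= x <= b -> Cdiff w (x, y) (wx (x, y)) (wy (x, y)) /\ continuous wx (x, y)) ->
  CInt (fun x => wx (x, y)) a b = (w (b, y) - w (a, y))%C.
Proof.
intros ab H; apply (CInt_derive (fun x => w (x, y))); [easy|..]; intros x Hx; destruct (H x Hx) as [D c].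
- apply (is_derive_Cdiff _ _ _ _ _ D).
- apply (is_derive_Cdiff _ _ _ _ _ D).
- now apply continuous_hor.
Qed.

Lemma CInt_ver_C1 w wx wy x c d : c <= d ->
  (forall y, c <= y <= d -> Cdiff w (x, y) (wx (x, y)) (wy (x, y)) /\ continuous wy (x, y)) ->
  CInt (fun y => wy (x, y)) c d = (w (x, d) - w (x, c))%C.
Proof.
intros cd H; apply (CInt_derive (fun y => w (x, y))); [easy|..]; intros y Hy; destruct (H y Hy) as [D cc].
- apply (is_derive_Cdiff _ _ _ _ _ D).
- apply (is_derive_Cdiff _ _ _ _ _ D).
- now apply continuous_ver.
Qed.

(** The form [wx dx + wy dy] is exact, and it is half the sum of
    [(wx - Ci * wy) dz] and [(wx + Ci * wy) d(conj z)]. *)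
Lemma rect_int_dz_dzbar w wx wy a b c d : a <= b -> c <= d ->
  (forall z, box a b c d z -> Cdiff w z (wx z) (wy z) /\ continuous wx z /\ continuous wy z) ->
  rect_int (fun z => wx z - Ci * wy z)%C a b c d =
   (- Cconj (rect_int (fun z => Cconj (wx z + Ci * wy z)) a b c d))%C.
Proof.
intros ab cd H.
assert (Hx : cont_frame wx a b c d) by (intros z [Hz _]; now apply H).
assert (Hy : cont_frame wy a b c d) by (intros z [Hz _]; now apply H).
assert (Hi : forall k, cont_frame (fun z => k * wy z)%C a b c d).
{ intros k z Hz; apply continuous_Cmult; [apply continuous_Cconst|now apply Hy]. }
assert (Hs : cont_frame (fun z => wx z + Ci * wy z)%C a b c d).
{ intros z Hz; apply continuous_Cplus; [now apply Hx|now apply Hi]. }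
rewrite (rect_ext (fun z => wx z - Ci * wy z)%C (fun z => wx z + (- Ci) * wy z)%C) by (easy || intros; ring).
rewrite rect_plus, rect_scal; try easy; try apply Hi.
destruct (ex_RInt_frame _ _ _ _ _ ab cd Hs) as (s1 & s2 & s3 & s4).
destruct (ex_RInt_frame _ _ _ _ _ ab cd Hx) as (x1 & x2 & x3 & x4).
destruct (ex_RInt_frame _ _ _ _ _ ab cd Hy) as (y1 & y2 & y3 & y4).
destruct (ex_RInt_frame _ _ _ _ _ ab cd (Hi Ci)) as (i1 & i2 & i3 & i4).
unfold rect_int.
rewrite (CInt_conj _ _ _ s1), (CInt_conj _ _ _ s2), (CInt_conj _ _ _ s3), (CInt_conj _ _ _ s4).
rewrite (CInt_plus _ _ _ _ x1 i1), (CInt_plus _ _ _ _ x2 i2), (CInt_plus _ _ _ _ x3 i3), (CInt_plus _ _ _ _ x4 i4).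
rewrite (CInt_Cmult_l _ _ _ _ y1), (CInt_Cmult_l _ _ _ _ y2), (CInt_Cmult_l _ _ _ _ y3), (CInt_Cmult_l _ _ _ _ y4).
assert (Eb := CInt_hor_C1 w wx wy a b c ab ltac:(intros x ?; split; apply H; split; simpl; lra)).
assert (Et := CInt_hor_C1 w wx wy a b d ab ltac:(intros x ?; split; apply H; split; simpl; lra)).
assert (El := CInt_ver_C1 w wx wy a c d cd ltac:(intros x ?; split; apply H; split; simpl; lra)).
assert (Er := CInt_ver_C1 w wx wy b c d cd ltac:(intros x ?; split; apply H; split; simpl; lra)).
rewrite Eb, Et, El, Er.
apply injective_projections; simpl; ring.
Qed.

(** Formally, the operators commute: the d-bar derivative of [d_z w] is the
    [d_z] derivative of [G], the d-bar derivative of [w].  Only first derivatives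
    of [w] are available; since [w] has exact differential, the contour integral
    of [d_z w] is that of [G] against [- d(conj z)], and [G] is differentiable. *)
Lemma has_dbar_d_z (w wx wy G : C -> C) (p Gx Gy : C) :
  locally p (fun z => Cdiff w z (wx z) (wy z) /\ continuous wx z /\ continuous wy z /\
     (wx z + Ci * wy z)%C = G z) ->
  Cdiff G p Gx Gy ->
  has_dbar (fun z => wx z - Ci * wy z)%C p (Gx - Ci * Gy).
Proof.
intros L HG.
assert (Lc : locally p (continuous (fun z => Cconj (wx z + Ci * wy z)))).
{ revert L; apply filter_imp; intros z (_ & cx & cy & _); apply continuous_Cconj.
  apply continuous_Cplus; [easy|apply continuous_Cmult; [apply continuous_Cconst|easy]]. }
assert (D : has_dbar (fun z => Cconj (wx z + Ci * wy z)) p (Cconj Gx + Ci * Cconj Gy)).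
{ apply has_dbar_Cdiff; [easy|].
  apply Cdiff_ext with (fun z => Cconj (G z)); [|now apply Cdiff_conj].
  revert L; apply filter_imp; intros z (_ & _ & _ & ->); easy. }
apply has_dbar_intro.
- revert L; apply filter_imp; intros z (_ & cx & cy & _).
  apply continuous_Cminus; [easy|apply continuous_Cmult; [apply continuous_Cconst|easy]].
- intros eps e0; destruct (proj2 D _ e0) as (d1 & d1p & H1).
  destruct (locally_box _ _ L) as (d2 & d2p & H2).
  exists (Rmin d1 d2); split; [now apply Rmin_glb_lt|].
  intros a b c d ab cd Hp Hs _.
  generalize (Rmin_l d1 d2) (Rmin_r d1 d2); intros.
  specialize (H1 _ _ _ _ Hp ltac:(lra)); specialize (H2 _ _ _ _ Hp ltac:(lra)).
  rewrite (rect_int_dz_dzbar w) by (easy || (intros z Hz; destruct (H2 z Hz) as (? & ? & ? & _); easy)).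
  set (I := rect_int _ a b c d) in *.
  rewrite <- Cmod_conj, <- Cmod_opp.
  eapply Rle_trans; [right|exact H1]; f_equal.
  apply injective_projections; simpl; ring.
Qed.

(** * The Vekua equation *)
Lemma Cn_on_2_spec (Omega : C -> Prop) (f : C -> R) : open Omega -> Cn_on 2 Omega f ->
  Cn_on 1 Omega f /\ Cn_on 1 Omega (pdx f) /\ Cn_on 1 Omega (pdy f) /\
  forall z, Omega z -> pdx (pdy f) z = pdy (pdx f) z.
Proof.
intros Op H; split; [|split; [|split]].
- intros x y Hz; apply (ex_diff_n_m 2 1); [auto|now apply H].
- intros x y Hz; apply (ex_diff_n_deriv_aux1 (fun s t => f (s, t))), (H x y Hz).
- intros x y Hz; apply (ex_diff_n_deriv_aux2 (fun s t => f (s, t))), (H x y Hz).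
- intros [x y] Hz.
  destruct (H x y Hz) as (_ & _ & _ & (_ & _ & _ & _ & (cxy & _)) & (_ & _ & _ & (cyx & _) & _)).
  refine (Schwarz (fun s t => f (s, t)) x y _ cyx cxy).
  apply locally_2d_locally; generalize (Op _ Hz); apply filter_imp; intros [s t] Hst.
  destruct (H s t Hst) as (_ & e1 & e2 & (_ & _ & e3 & _) & (_ & e4 & _ & _)).
  repeat split; assumption.
Qed.

Lemma cpdx_RtoC (g : C -> R) z : cpdx (fun q => RtoC (g q)) z = RtoC (pdx g z).
Proof. apply injective_projections; [reflexivity|exact (Derive_const 0 (Re z))]. Qed.

Lemma cpdy_RtoC (g : C -> R) z : cpdy (fun q => RtoC (g q)) z = RtoC (pdy g z).
Proof. apply injective_projections; [reflexivity|exact (Derive_const 0 (Im z))]. Qed.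

Lemma Cdiff_inv_R (f : C -> R) p (fx fy : R) :
  Cdiff (fun z => RtoC (f z)) p (RtoC fx) (RtoC fy) -> f p <> 0 ->
  Cdiff (fun z => / RtoC (f z))%C p (RtoC (- fx * / f p * / f p)) (RtoC (- fy * / f p * / f p)).
Proof.
intros H H0.
assert (n0 : RtoC (f p) <> 0) by (intros E; apply H0; injection E; easy).
eapply Cdiff_eq; [apply (Cdiff_inv _ _ _ _ H n0)|..]; rewrite !RtoC_mult, !RtoC_inv, RtoC_opp by easy; field; easy.
Qed.

Lemma has_dbar_differentiable (h : C -> C) p al be :
  locally p (fun z => exists a b, Cdiff h z a b) -> Cdiff h p al be -> has_dbar h p (al + Ci * be).
Proof.
intros L D; apply has_dbar_Cdiff; [|easy].
revert L; apply filter_imp; intros z (a & b & E); now apply Cdiff_continuous in E.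
Qed.

Lemma Cplus_eq_minus (x y z : C) : (x + y = z -> x = z - y)%C.
Proof. intros <-; ring. Qed.

Theorem theorem22 :
  forall (Omega : C -> Prop) (u f0 : C -> R) (w : C -> C),
    is_domain Omega ->
    schrodinger_solution Omega u f0 ->
    (forall z, Omega z -> f0 z <> 0%R) ->
    let F0 : C -> C := fun z => RtoC (f0 z) in
    let b : C -> C := fun z => (- (d_zbar F0 z / F0 z))%C in
    let v : C -> C :=
      fun z => (Ci * (d_z w z + d_z F0 z / F0 z * Cconj (w z)))%C in
    vekua_solution Omega b w ->
    vekua_solution Omega (fun z => Cconj (b z)) v.
Proof.
intros Omega u f0 w [Op _] [Cf _] nz F0 b v [Cw Ew].
destruct (Cn_on_2_spec _ _ Op Cf) as (C0 & Cx & Cy & Sym).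
assert (S0 := Cn_on_1_spec _ _ Op C0); assert (Sx := Cn_on_1_spec _ _ Op Cx); assert (Sy := Cn_on_1_spec _ _ Op Cy).
assert (Sw := C1_on_spec _ _ Op Cw).
assert (Si := Cn_on_1_spec _ _ Op (proj2 Cw)).
set (fx := pdx f0) in *; set (fy := pdy f0) in *.
set (wx := cpdx w) in *; set (wy := cpdy w) in *.
assert (Eb : forall z, b z = (- ((RtoC (fx z) + Ci * RtoC (fy z)) * / RtoC (f0 z)))%C).
{ intros z; unfold b, d_zbar, F0; now rewrite cpdx_RtoC, cpdy_RtoC. }
set (V := fun z => (Ci * ((wx z - Ci * wy z) + (RtoC (fx z) - Ci * RtoC (fy z)) * / RtoC (f0 z) * Cconj (w z)))%C).
assert (Ev : forall z, v z = V z).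
{ intros z; unfold v, V, d_z, F0; now rewrite cpdx_RtoC, cpdy_RtoC. }
assert (Dinv : forall z, Omega z -> Cdiff (fun q => / RtoC (f0 q))%C z
    (RtoC (- fx z * / f0 z * / f0 z)) (RtoC (- fy z * / f0 z * / f0 z))).
{ intros z Hz; apply Cdiff_inv_R; [now apply S0|now apply nz]. }
assert (DN : forall k z, Omega z -> Cdiff (fun q => RtoC (fx q) + k * RtoC (fy q))%C z
    (RtoC (pdx fx z) + k * RtoC (pdy fx z)) (RtoC (pdy fx z) + k * RtoC (pdy fy z))).
{ intros k z Hz; eapply Cdiff_eq; [apply Cdiff_plus; [now apply Sx|]; apply Cdiff_mult;
    [apply Cdiff_const|now apply Sy]|..]; cbv beta; [rewrite Sym by easy|]; ring. }
assert (Dw : forall z, Omega z -> Cdiff (fun q => Cconj (w q)) z (Cconj (wx z)) (Cconj (wy z))).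
{ intros z Hz; now apply Cdiff_conj, Sw. }
assert (Rel : forall z, Omega z -> (wx z + Ci * wy z =
   - ((RtoC (fx z) + Ci * RtoC (fy z)) * / RtoC (f0 z)) * Cconj (w z))%C).
{ intros z Hz; rewrite <- Eb; exact (Ew z Hz). }
(* The equation in the areolar sense.  Once [wx] is eliminated by the equation
   for [w], the identity is polynomial in the real parts, the imaginary parts
   and [/ f0 z]. *)
assert (Dv : forall z, Omega z -> has_dbar V z (Cconj (b z) * Cconj (V z))).
{ intros z Hz.
  assert (D2 : forall q, Omega q -> exists al be, Cdiff (fun q => (RtoC (fx q) + (- Ci) * RtoC (fy q)) * / RtoC (f0 q) * Cconj (w q))%C q al be).
  { intros q Hq; eexists; eexists; apply Cdiff_mult; [apply Cdiff_mult; [apply DN|apply Dinv]|apply Dw]; easy. }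
  eapply has_dbar_eq.
  - apply has_dbar_ext with (fun q => Ci * ((wx q - Ci * wy q) + (RtoC (fx q) + (- Ci) * RtoC (fy q)) * / RtoC (f0 q) * Cconj (w q)))%C.
    { apply filter_forall; intros q; unfold V; ring. }
    apply has_dbar_scal, has_dbar_plus.
    + apply (has_dbar_d_z w wx wy (fun q => (-(1)) * ((RtoC (fx q) + Ci * RtoC (fy q)) * / RtoC (f0 q)) * Cconj (w q))%C).
      * generalize (Op z Hz); apply filter_imp; intros q Hq; destruct (Sw q Hq) as (? & ? & ?).
        repeat split; try easy; rewrite (Rel q Hq); ring.
      * apply Cdiff_mult; [|now apply Dw].
        apply Cdiff_mult; [apply Cdiff_const|]; apply Cdiff_mult; [now apply DN|now apply Dinv].
    + apply has_dbar_differentiable; [generalize (Op z Hz); now apply filter_imp|].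
      apply Cdiff_mult; [apply Cdiff_mult; [now apply DN|now apply Dinv]|now apply Dw].
  - rewrite Eb; unfold V.
    generalize (Rel z Hz); rewrite <- RtoC_inv by now apply nz.
    intros E; apply Cplus_eq_minus in E; revert E.
    generalize (/ f0 z) (wx z) (wy z) (w z) (fx z) (fy z) (pdx fx z) (pdy fx z) (pdy fy z).
    clear; intros g px py [w1 w2] fx fy fxx fxy fyy ->; destruct py as [r s].
    apply injective_projections; simpl; ring. }
(* [a] is [2 * d_z f0], [psi] is [Im w / f0] and [gam] is minus twice the
   Laplacian of [f0]. *)
destruct (pompeiu_C1 Omega V (fun z => RtoC 2 * (RtoC (fx z) + (- Ci) * RtoC (fy z)))%C
   (fun z => RtoC (Im (w z)) * / RtoC (f0 z))%C
   (fun z => - (RtoC 2 * (RtoC (pdx fx z) + RtoC (pdy fy z))))%C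
   (fun z => RtoC (pdx (fun q => Im (w q)) z) * / RtoC (f0 z) + RtoC (Im (w z)) * RtoC (- fx z * / f0 z * / f0 z))%C
   (fun z => RtoC (pdy (fun q => Im (w q)) z) * / RtoC (f0 z) + RtoC (Im (w z)) * RtoC (- fy z * / f0 z * / f0 z))%C)
  as (vx & vy & Hv).
- exact Op.
- intros z Hz; eapply has_dbar_continuous, Dv, Hz.
- intros z Hz; eexists; eexists; apply Cdiff_mult; [apply Cdiff_const|now apply DN].
- intros z Hz; apply continuous_Copp, continuous_Cmult; [apply continuous_Cconst|].
  apply continuous_Cplus; [exact (proj1 (proj2 (Sx z Hz)))|exact (proj2 (proj2 (Sy z Hz)))].
- intros z Hz; destruct (Si z Hz) as (Di & cix & ciy).
  assert (ci := Cdiff_continuous _ _ _ _ Di); assert (cv := Cdiff_continuous _ _ _ _ (Dinv z Hz)).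
  assert (ck : forall k : C -> R, continuous (fun q => RtoC (k q)) z ->
    continuous (fun q => RtoC (- k q * / f0 q * / f0 q)) z).
  { intros k Hk; apply (continuous_ext_loc _ (fun q => - RtoC (k q) * / RtoC (f0 q) * / RtoC (f0 q)))%C.
    - generalize (Op z Hz); apply filter_imp; intros q Hq; rewrite !RtoC_mult, RtoC_opp, !RtoC_inv by (now apply nz); easy.
    - apply continuous_Cmult; [apply continuous_Cmult; [apply continuous_Copp|]|]; easy. }
  split; [exact (Cdiff_mult _ _ _ _ _ _ _ Di (Dinv z Hz))|].
  destruct (S0 z Hz) as (_ & cfx & cfy).
  split; (apply continuous_Cplus; apply continuous_Cmult; [easy|easy| |apply ck; easy]);
    exact (continuous_Im w z (Cdiff_continuous _ _ _ _ (proj1 (Sw z Hz)))).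
- intros z0 z Hz0 Hz; destruct (Si z Hz) as (Di & _ & _).
  set (psi := fun q => (RtoC (Im (w q)) * / RtoC (f0 q))%C).
  assert (D2 : forall q, Omega q -> exists al be,
    Cdiff (fun q => RtoC 2 * (RtoC (fx q) + (- Ci) * RtoC (fy q)) * (RtoC (Im (w q)) * / RtoC (f0 q) + - psi z0))%C q al be).
  { intros q Hq; eexists; eexists; apply Cdiff_mult; [apply Cdiff_mult; [apply Cdiff_const|now apply DN]|].
    apply Cdiff_plus; [|apply Cdiff_const]; apply Cdiff_mult; [now apply Si|now apply Dinv]. }
  eapply has_dbar_eq.
  + apply has_dbar_ext with (fun q => V q + (-(1)) * (RtoC 2 * (RtoC (fx q) + (- Ci) * RtoC (fy q)) * (RtoC (Im (w q)) * / RtoC (f0 q) + - psi z0)))%C.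
    { apply filter_forall; intros q; unfold psi; ring. }
    apply has_dbar_plus; [now apply Dv|]; apply has_dbar_scal, has_dbar_differentiable; [generalize (Op z Hz); now apply filter_imp|].
    apply Cdiff_mult; [apply Cdiff_mult; [apply Cdiff_const|now apply DN]|].
    apply Cdiff_plus; [|apply Cdiff_const]; apply Cdiff_mult; [exact Di|now apply Dinv].
  + change (RtoC (Im (w z0)) * / RtoC (f0 z0))%C with (psi z0).
    rewrite Eb; unfold V.
    generalize (Rel z Hz); rewrite <- RtoC_inv by now apply nz.
    intros E; apply Cplus_eq_minus in E; revert E.
    change (pdx (fun q => Im (w q)) z) with (snd (wx z)); change (pdy (fun q => Im (w q)) z) with (snd (wy z)).
    generalize (/ f0 z) (wx z) (wy z) (w z) (fx z) (fy z) (pdx fx z) (pdy fx z) (pdy fy z) (psi z0).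
    clear; intros g px py [w1 w2] fx fy fxx fxy fyy [p1 p2] ->; destruct py as [r s].
    apply injective_projections; simpl; ring.
- assert (Hv' : forall z, Omega z -> Cdiff v z (vx z) (vy z) /\ continuous vx z /\ continuous vy z).
  { intros z Hz; destruct (Hv z Hz) as (D & cx & cy); split; [|easy].
    apply Cdiff_ext with V; [apply filter_forall; intros q; symmetry; apply Ev|exact D]. }
  split; [now apply (C1_on_intro Omega v vx vy)|].
  intros z Hz; rewrite Ev; apply (has_dbar_unique V z); [|now apply Dv].
  unfold d_zbar; destruct (cpdx_cpdy_Cdiff v z _ _ (proj1 (Hv' z Hz))) as [-> ->].
  apply has_dbar_Cdiff; [|now apply Hv].
  generalize (Op z Hz); apply filter_imp; intros q Hq; apply (Cdiff_continuous _ _ _ _ (proj1 (Hv q Hq))).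
Qed.
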